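(* Let $r > 0$ and let $V : (-r, r) \to \mathbb{R}$ be bounded, measurable and symmetric, i.e. $V(-x) = V(x)$ for all $x \in (-r, r)$. Then the following assertions hold. (i) If $V$ is convex and non-constant, then $\lambda_1(V) < \mu_2(V)$. (ii) If $V$ is concave and non-constant, then $\mu_2(V) < \lambda_1(V)$.
   Context: For a bounded open interval $\Omega = (a,b)$ and a bounded measurable function $V : \Omega \to \mathbb{R}$, denote by $\mu_1(V) < \mu_2(V) \leq \mu_3(V) \leq \dots$ the eigenvalues, counted with multiplicities, of the self-adjoint Neumann Schrödinger operator $u \mapsto -u'' + V u$ in $L^2(\Omega)$ with domain $\{u \in H^2(\Omega) : u'(a) = u'(b) = 0\}$, and by $\lambda_1(V) < \lambda_2(V) \leq \lambda_3(V) \leq \dots$ the eigenvalues, counted with multiplicities, of the self-adjoint Dirichlet Schrödinger operator $u \mapsto -u'' + V u$ in $L^2(\Omega)$ with domain $\{u \in H^2(\Omega) : u(a) = u(b) = 0\}$. In the claim, $\Omega = (-r, r)$. *)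

(* Defs.v *)
From HB Require Import structures.
From mathcomp Require Export all_boot all_order all_algebra.
From mathcomp Require Export all_classical all_reals all_analysis.
Export Order.TTheory GRing.Theory Num.Theory.
Export numFieldNormedType.Exports.

Set Implicit Arguments.
Unset Strict Implicit.
Unset Printing Implicit Defensive.

Local Open Scope classical_set_scope.
Local Open Scope card_scope.
Local Open Scope ring_scope.

(* Functions on an interval are total functions R -> R of which only the
   restriction to the interval matters; elements of L^2 are such functions,
   identified when they agree a.e. on the interval. The scalar field is real. *)

Definition same_ae (R : realType) (a b : R) (u v : R -> R) : Prop :=
  {ae @lebesgue_measure R, forall x, x \in `]a, b[ -> u x = v x}.

Definition in_L2 (R : realType) (a b : R) (u : R -> R) : Prop :=
  u \_ `]a, b[ \in Lfun (@lebesgue_measure R) 2%:E.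

Definition test_function (R : realType) (a b : R) (phi : R -> R) : Prop :=
  [/\ forall x, derivable phi x 1,
      continuous (phi^`())%classic &
      exists K : set R, [/\ compact K, K `<=` `]a, b[%classic &
                            forall x, ~ K x -> phi x = 0]].

(* Test functions are of class C^1 with compact support. *)
Definition weak_derivative (R : realType) (a b : R) (u u' : R -> R) : Prop :=
  forall phi, test_function a b phi ->
    \int[@lebesgue_measure R]_(x in `]a, b[) (u x * (phi^`())%classic x) =
    - \int[@lebesgue_measure R]_(x in `]a, b[) (u' x * phi x).

(* u is in H^2(a, b), with first and second weak derivatives u1 and u2. *)
Definition in_H2 (R : realType) (a b : R) (u u1 u2 : R -> R) : Prop :=
  [/\ in_L2 a b u, in_L2 a b u1, in_L2 a b u2,
      weak_derivative a b u u1 & weak_derivative a b u1 u2].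

(* The representative of u that is continuous on [a, b] has value v at x. *)
Definition trace (R : realType) (a b : R) (u : R -> R) (x v : R) : Prop :=
  exists w : R -> R,
    [/\ {within `[a, b], continuous w}, same_ae a b u w & w x = v].

(* Unbounded operators in L^2(a, b) are given by their graphs:
   "A u f" means that u is in the domain of A and that A u = f. *)

Definition neumann_schrodinger (R : realType) (a b : R) (V : R -> R)
    (u f : R -> R) : Prop :=
  exists u1 u2 : R -> R,
    [/\ in_H2 a b u u1 u2, trace a b u1 a 0, trace a b u1 b 0 &
        same_ae a b f (fun x => - u2 x + V x * u x)].

Definition dirichlet_schrodinger (R : realType) (a b : R) (V : R -> R)
    (u f : R -> R) : Prop :=
  exists u1 u2 : R -> R,
    [/\ in_H2 a b u u1 u2, trace a b u a 0, trace a b u b 0 &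
        same_ae a b f (fun x => - u2 x + V x * u x)].

Definition eigenspace_of (R : realType) (A : (R -> R) -> (R -> R) -> Prop)
    (t : R) : set (R -> R) :=
  [set u | A u (fun x => t * u x)].

(* The subspace E of L^2(a, b) has a basis with n elements. *)
Definition has_dimension (R : realType) (a b : R) (E : set (R -> R))
    (n : nat) : Prop :=
  exists e : 'I_n -> R -> R,
    [/\ forall i, E (e i),
        forall c : 'I_n -> R,
          same_ae a b (fun x => \sum_(i < n) c i * e i x) (cst 0) ->
          forall i, c i = 0 &
        forall u, E u -> exists c : 'I_n -> R,
          same_ae a b u (fun x => \sum_(i < n) c i * e i x)].

(* l 1 <= l 2 <= l 3 <= ... is the list of all eigenvalues of A, each repeated
   according to its multiplicity; l 0 is irrelevant. A number t that is not an
   eigenvalue has multiplicity 0, hence does not occur in the list. *)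
Definition eigenvalues (R : realType) (a b : R)
    (A : (R -> R) -> (R -> R) -> Prop) (l : nat -> R) : Prop :=
  (forall j k : nat, (1 <= j)%N -> (j <= k)%N -> l j <= l k) /\
  (forall t : R, exists n : nat,
     has_dimension a b (eigenspace_of A t) n /\
     [set k | (1 <= k)%N /\ l k = t] #= `I_n).

Definition constant_on (R : realType) (D : set R) (V : R -> R) : Prop :=
  exists c : R, forall x, x \in D -> V x = c.

Definition convex_on (R : realType) (D : set R) (V : R -> R) : Prop :=
  @convex_function R R^o D V.

Definition concave_on (R : realType) (D : set R) (V : R -> R) : Prop :=
  @convex_function R R^o D (fun x => - V x).

(* Main.v *)
Require Import Defs.
From mathcomp Require Import ring lra measurable_realfun.
Set Implicit Arguments.
Unset Strict Implicit.
Unset Printing Implicit Defensive.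
Local Open Scope classical_set_scope.
Local Open Scope ring_scope.

(** Inside [(-r, r)] the potential is continuous and monotone in [|x|], so it
    extends to an even, bounded, continuous [W] on the line. For a real [t] let
    [C t] and [S t] be the solutions of [u'' = (W - t) u] with data [(1, 0)] and
    [(0, 1)] at [0]; the first is even, the second odd, and
    [C S' - C' S = 1]. Every weak eigenfunction is almost everywhere a
    combination of [C t] and [S t] ([weak_solution_classical]), hence [t] is a
    Neumann eigenvalue iff [C' t r = 0] or [S' t r = 0], and a Dirichlet
    eigenvalue iff [C t r = 0] or [S t r = 0].

    Let [l] be the least Dirichlet eigenvalue. If [C t] had a zero in [(0, r)]
    for some [t <= l], then decreasing the parameter would push that zero to [r]
    and produce a Dirichlet eigenvalue below [l]; so [C t > 0] on [[0, r)] for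
    all [t <= l] ([C_positive]), and then [S t > 0] on [(0, r)] because
    [(S / C)' = C ^- 2].

    Everything rests on the identity
    [(C' S')' = (W - t) (C S)'].
    The function [C S] vanishes at [0] and is positive inside, so an integration
    by parts against the monotone [W], carried out with finite differences,
    gives the sign of [C' S' - (W - t) C S] at [r]: negative if [W] increases
    away from [0], positive if it decreases ([integration_sign_change]).

    If [W] increases, that sign excludes [S' t r = 0] for [t <= l]
    ([increasing_odd_neumann]); so a Neumann eigenvalue [<= l] belongs to the
    even [C t > 0], and two orthogonal positive functions do not exist
    ([even_neumann_unique]). Hence at most one Neumann eigenvalue is [<= l].

    If [W] decreases, take [t = l]: there [C l r = 0], and the sign gives
    [S' l r < 0], while [C' l r < 0] is clear. For very negative [t] both
    [C' t r] and [S' t r] are positive, so each of them vanishes at some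
    parameter below [l] ([two_neumann_below]); these are two Neumann
    eigenvalues. *)

(** * Derivatives, monotonicity and energy estimates *)

Section Calculus.
Context {R : realType}.
Implicit Types (f g : R -> R) (a b c x y k M : R).

(** The derivation rules for functions given as explicit abstractions, so that the
    derivative of a compound expression is assembled by applying them. *)
Lemma isderiveD f g x df dg : is_derive x 1 f df -> is_derive x 1 g dg ->
  is_derive x 1 (fun y => f y + g y) (df + dg).
Proof. by move=> hf hg; exact: is_deriveD. Qed.

Lemma isderiveB f g x df dg : is_derive x 1 f df -> is_derive x 1 g dg ->
  is_derive x 1 (fun y => f y - g y) (df - dg).
Proof. by move=> hf hg; exact: is_deriveB. Qed.

Lemma isderiveN f x df : is_derive x 1 f df -> is_derive x 1 (fun y => - f y) (- df).
Proof. by move=> hf; exact: is_deriveN. Qed.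

Lemma isderiveM f g x df dg : is_derive x 1 f df -> is_derive x 1 g dg ->
  is_derive x 1 (fun y => f y * g y) (df * g x + f x * dg).
Proof.
by move=> hf hg; apply: (is_derive_eq (is_deriveM hf hg)); rewrite /GRing.scale /=; ring.
Qed.

Lemma isderiveZ k f x df : is_derive x 1 f df ->
  is_derive x 1 (fun y => k * f y) (k * df).
Proof.
move=> hf; apply: (is_derive_eq (isderiveM (is_derive_cst k x 1) hf)).
by rewrite mul0r add0r.
Qed.

Lemma isderive_comp f g x df dg : is_derive (g x) 1 f df -> is_derive x 1 g dg ->
  is_derive x 1 (fun y => f (g y)) (df * dg).
Proof. exact: is_derive1_comp. Qed.

Lemma isderive_continuous f (df : R -> R) : (forall x, is_derive x 1 f (df x)) ->
  continuous f.
Proof.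
move=> h x; apply: differentiable_continuous; apply/derivable1_diffP.
by case: (h x).
Qed.

Lemma mean_value f (df : R -> R) a b : a <= b ->
  (forall x, a <= x <= b -> is_derive x 1 f (df x)) ->
  exists2 c, a <= c <= b & f b - f a = df c * (b - a).
Proof.
move=> ab h.
have [||c cab e] := @MVT_segment R f df a b ab.
- by move=> x; rewrite in_itv /= => /andP[/ltW ax /ltW xb]; apply: h; rewrite ax.
- apply: derivable_within_continuous => x; rewrite in_itv /= => xab.
  by case: (h x xab).
by exists c; rewrite // -in_itv.
Qed.

Lemma deriv_ge0_le f (df : R -> R) a b : a <= b ->
  (forall x, a <= x <= b -> is_derive x 1 f (df x)) ->
  (forall x, a <= x <= b -> 0 <= df x) -> f a <= f b.
Proof.
move=> ab h d; have [c cab e] := mean_value ab h.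
by rewrite -subr_ge0 e mulr_ge0 ?d ?subr_ge0.
Qed.

Lemma deriv_gt0_lt f (df : R -> R) a b : a < b ->
  (forall x, a <= x <= b -> is_derive x 1 f (df x)) ->
  (forall x, a <= x <= b -> 0 < df x) -> f a < f b.
Proof.
move=> ab h d; have [c cab e] := mean_value (ltW ab) h.
by rewrite -subr_gt0 e mulr_gt0 ?d ?subr_gt0.
Qed.

Lemma isderive_reflect f (df : R -> R) x : is_derive (- x) 1 f (df (- x)) ->
  is_derive x 1 (fun y => f (- y)) (- df (- x)).
Proof.
move=> h; have h2 := isderiveN (is_derive_id x 1).
by apply: (is_derive_eq (isderive_comp h h2)); rewrite mulrN1.
Qed.

Lemma isderive_expR k x :
  is_derive x 1 (fun y => expR (k * y)) (k * expR (k * x)).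
Proof.
have h2 := isderiveZ k (is_derive_id x 1).
by apply: (is_derive_eq (isderive_comp (is_derive_expR _) h2)); rewrite mulr1 mulrC.
Qed.

(** [e x * expR (- k * x)] is nonincreasing. *)
Lemma gronwall (e de : R -> R) k a b : a <= b ->
  (forall x, a <= x <= b -> is_derive x 1 e (de x)) ->
  (forall x, a <= x <= b -> de x <= k * e x) ->
  e b <= e a * expR (k * (b - a)).
Proof.
move=> ab he hde.
have hd x : a <= x <= b ->
    is_derive x 1 (fun y => - (e y * expR (- k * y)))
      ((k * e x - de x) * expR (- k * x)).
  move=> xab; apply: (is_derive_eq (isderiveN (isderiveM (he _ xab) (isderive_expR (- k) x)))).
  by ring.
have : - (e a * expR (- k * a)) <= - (e b * expR (- k * b)).
  apply: (deriv_ge0_le ab hd) => x xab.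
  by rewrite mulr_ge0 ?expR_ge0// subr_ge0 hde.
rewrite lerN2 => h.
have -> : k * (b - a) = - (- k * b) + (- k * a) by ring.
by rewrite expRD mulrCA expRN mulrC ler_pdivlMr ?expR_gt0.
Qed.

(** The equation [u'' = q u] on [D], written as a first-order system so that no
    second derivative has to be named. *)
Definition solution (D : set R) (q u v : R -> R) : Prop :=
  forall x, D x -> is_derive x 1 u (v x) /\ is_derive x 1 v (q x * u x).

(** The energy [u ^+ 2 + v ^+ 2] has derivative [2 u v (1 + q)], at most
    [(1 + M)] times the energy itself. *)
Lemma energy_bound q u v M a b : a <= b ->
  (forall x, a <= x <= b -> `|q x| <= M) ->
  solution [set x | a <= x <= b] q u v ->
  u b ^+ 2 + v b ^+ 2 <=
    (u a ^+ 2 + v a ^+ 2) * expR ((1 + M) * (b - a)).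
Proof.
move=> ab qM s.
apply: (@gronwall (fun x => u x ^+ 2 + v x ^+ 2)
  (fun x => 2 * (u x * v x) * (1 + q x))) => // x xab.
  have [su sv] := s _ xab.
  rewrite (_ : (fun x0 : R => _) = (fun x => u x * u x + v x * v x)).
    by apply: (is_derive_eq (isderiveD (isderiveM su su) (isderiveM sv sv))); ring.
  by apply/funext => y; rewrite !expr2.
have := qM _ xab; rewrite ler_norml => /andP[q1 q2].
have h1 : 0 <= (u x + v x) ^+ 2 by apply: sqr_ge0.
have h2 : 0 <= (u x - v x) ^+ 2 by apply: sqr_ge0.
have : 0 <= (M - q x) * ((u x + v x) ^+ 2) by apply: mulr_ge0 => //; lra.
have : 0 <= (M + q x) * ((u x - v x) ^+ 2) by apply: mulr_ge0 => //; lra.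
have : 0 <= ((u x - v x) ^+ 2) by [].
set U := u x; set W := v x; set Q := q x.
nra.
Qed.

End Calculus.

(** * Existence of solutions *)

Section Antiderivative.
Context {R : realType}.
Notation mu := (@lebesgue_measure R).
Implicit Types (f g : R -> R).

Let anti_from f (A : R) (x : R) : R :=
  \int[mu]_(t in `[- A, x]) f t - \int[mu]_(t in `[- A, 0]) f t.

Let anti_from_derive f (A x : R) : continuous f -> - A < x ->
  is_derive x 1 (anti_from f A) (f x).
Proof.
move=> cf Ax.
have h : mu.-integrable `[- A, x + 1] (EFin \o f).
  apply: continuous_compact_integrable; first exact: segment_compact.
  exact: continuous_subspaceT.
have [|d1 d2] := @continuous_FTC1 R f (BLeft (- A)) x (x + 1) _ h Ax (cf x).
  by rewrite ltrDl.
have d : is_derive x 1 (fun y => \int[mu]_(t in `[- A, y]) f t) (f x).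
  by apply: DeriveDef; [exact: d1|rewrite -derive1E; exact: d2].
rewrite /anti_from; apply: (is_derive_eq (isderiveB d (is_derive_cst _ x 1))).
by rewrite subr0.
Qed.

Let anti_from_eq f (A B x : R) : continuous f -> 0 < A -> 0 < B -> - A < x -> - B < x ->
  anti_from f A x = anti_from f B x.
Proof.
move=> cf A0 B0 Ax Bx.
have h y : - A < y -> - B < y ->
    is_derive y 1 (fun y => anti_from f A y - anti_from f B y) 0.
  move=> Ay By.
  apply: (is_derive_eq (isderiveB (anti_from_derive cf Ay) (anti_from_derive cf By))).
  by rewrite subrr.
have e0 : anti_from f A 0 - anti_from f B 0 = 0 by rewrite /anti_from !subrr.
apply/eqP; rewrite -subr_eq0; apply/eqP; rewrite -e0.
apply/eqP; rewrite -subr_eq0; apply/eqP.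
have [x0|x0] := leP 0 x.
- have [|c _ ->] := @mean_value _ (fun y => anti_from f A y - anti_from f B y)
    (cst 0) _ _ x0; last by rewrite mul0r.
  by move=> y /andP[y0 _]; apply: h; apply: lt_le_trans y0; rewrite oppr_lt0.
- have [|c _] := @mean_value _ (fun y => anti_from f A y - anti_from f B y)
    (cst 0) _ _ (ltW x0).
    move=> y /andP[y0 _]; apply: h; exact: lt_le_trans y0.
  by rewrite mul0r => /eqP; rewrite -oppr_eq0 opprB => /eqP.
Qed.

(** Integrals from a fixed base point only give a derivative to the right of it.
    Since two base points give the same function once it is normalised at [0],
    the base point may move with [x]. *)
Lemma antiderivative_exists f : continuous f ->
  exists F : R -> R, F 0 = 0 /\ forall x : R, is_derive x 1 F (f x).
Proof.
move=> cf; exists (fun x => anti_from f (`|x| + 1) x).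
split; first by rewrite /anti_from subrr.
move=> x.
have p (y : R) : 0 <= `|y| by [].
have bx (y : R) : - (`|y| + 1) < y.
  by have := ler_norm (- y); rewrite normrN; lra.
apply: (@near_eq_is_derive _ _ _ (anti_from f (`|x| + 2))); last first.
  by apply: anti_from_derive => //; have := bx x; lra.
near=> y.
have xy : `|x - y| < 1 by near: y; apply: cvgr_dist_lt => //; exact: cvg_id.
have A0 : 0 < `|x| + 2 by have := p x; lra.
have B0 : 0 < `|y| + 1 by have := p y; lra.
have Ay : - (`|x| + 2) < y.
  by move: xy; rewrite ltr_norml => /andP[h1 h2]; have := bx x; lra.
exact: anti_from_eq cf A0 B0 Ay (bx y).
Unshelve. all: by end_near. Qed.

End Antiderivative.

Section Existence.
Context {R : realType}.
Implicit Types (f g F G : R -> R) (x y : R).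

(** The limit is the supremum of the increasing sequence [s n - c / 2 ^+ n]; it
    stays below the decreasing sequence [s n + c / 2 ^+ n], which yields the rate
    of convergence together with the limit. *)
Lemma sum_of_halves (s : nat -> R) (c : R) :
  (forall n, `|s n.+1 - s n| <= c / 2 ^+ n.+1) ->
  exists l, forall n, `|l - s n| <= c / 2 ^+ n.
Proof.
move=> h.
have hh n : c / 2 ^+ n = 2 * (c / 2 ^+ n.+1) :> R.
  by rewrite exprS; field; rewrite expf_neq0 ?pnatr_eq0.
have lo n : s n - c / 2 ^+ n <= s n.+1 - c / 2 ^+ n.+1.
  have := h n; have := hh n; rewrite ler_norml => + /andP[]; lra.
have up n : s n.+1 + c / 2 ^+ n.+1 <= s n + c / 2 ^+ n.
  have := h n; have := hh n; rewrite ler_norml => + /andP[]; lra.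
have LO m n : (m <= n)%N -> s m - c / 2 ^+ m <= s n - c / 2 ^+ n.
  by move=> /subnK <-; elim: (n - m)%N => // k ih; exact: le_trans ih (lo _).
have UP m n : (m <= n)%N -> s n + c / 2 ^+ n <= s m + c / 2 ^+ m.
  by move=> /subnK <-; elim: (n - m)%N => // k ih; exact: le_trans (up _) ih.
have c0 n : 0 <= c / 2 ^+ n.
  by have := le_trans (normr_ge0 _) (h n); have := hh n; lra.
pose S := [set s n - c / 2 ^+ n | n in [set: nat]].
have ub n : ubound S (s n + c / 2 ^+ n).
  move=> _ [m _ <-].
  have := LO _ _ (leq_maxl m n); have := UP _ _ (leq_maxr m n).
  have := c0 (maxn m n); lra.
have hS : has_sup S.
  split; last by exists (s 0 + c / 2 ^+ 0)%R; exact: ub.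
  by exists (s 0 - c / 2 ^+ 0), 0.
exists (sup S) => n; rewrite ler_norml; apply/andP; split.
- have : s n - c / 2 ^+ n <= sup S by apply: ub_le_sup; [case: hS|exists n].
  lra.
- have : sup S <= s n + c / 2 ^+ n by apply: ge_sup; [case: hS|exact: ub].
  lra.
Qed.

Lemma halves_small (a e : R) : 0 < e -> exists n, a / 2 ^+ n <= e.
Proof.
move=> e0; have [n hn] : exists n : nat, a / e < n%:R.
  exists (Num.trunc `|a / e|).+1; apply: le_lt_trans (ler_norm _) _.
  exact: truncnS_gt.
exists n; rewrite ler_pdivrMr ?exprn_gt0// mulrC -ler_pdivrMr//.
apply: (le_trans (ltW hn)); rewrite -natrX ler_nat.
by apply/ltnW; rewrite ltn_expl.
Qed.

Lemma halves_eq0 (z a : R) : (forall n, `|z| <= a / 2 ^+ n) -> z = 0.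
Proof.
move=> h; apply/eqP; rewrite -normr_le0; apply/ler_addgt0Pl => e e0.
by have [n hn] := halves_small a e0; rewrite addr0; apply: le_trans (h n) hn.
Qed.

Variable k : R.
Hypothesis k0 : 0 < k.

Let E (x : R) := expR (k * x) + expR (- k * x).
Let E_gt0 x : 0 < E x. Proof. by rewrite addr_gt0 ?expR_gt0. Qed.

(** Integration gains a factor [1 / k] in the norm weighted by [E]. The weight
    is even so that one estimate serves both half-lines: compare with its
    antiderivative [(expR (k x) - expR (- k x)) / k], which is odd. *)
Lemma antiderivative_dist f g F G (c : R) : F 0 = G 0 ->
  (forall x, is_derive x 1 F (f x)) -> (forall x, is_derive x 1 G (g x)) ->
  (forall x, `|f x - g x| <= c * E x) ->
  forall x, `|F x - G x| <= c / k * E x.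
Proof.
move=> FG0 dF dG h x.
have c0 : 0 <= c.
  by have := le_trans (normr_ge0 _) (h 0); rewrite pmulr_lge0.
have ck0 : 0 <= c / k by rewrite divr_ge0// ltW.
pose S (x : R) := c / k * (expR (k * x) - expR (- k * x)).
have dS y : is_derive y 1 S (c * E y).
  apply: (is_derive_eq (isderiveZ (c / k) (isderiveB (isderive_expR k y) (isderive_expR (- k) y)))).
  by rewrite /E; field; rewrite gt_eqF.
have S0 : S 0 = 0 by rewrite /S !mulr0 subrr mulr0.
have d1 y : is_derive y 1 (fun y => S y - (F y - G y)) (c * E y - (f y - g y)).
  exact: isderiveB (dS y) (isderiveB (dF y) (dG y)).
have d2 y : is_derive y 1 (fun y => S y + (F y - G y)) (c * E y + (f y - g y)).
  exact: isderiveD (dS y) (isderiveB (dF y) (dG y)).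
have p1 y : 0 <= c * E y - (f y - g y).
  by have := h y; rewrite ler_norml => /andP[]; lra.
have p2 y : 0 <= c * E y + (f y - g y).
  by have := h y; rewrite ler_norml => /andP[]; lra.
have SE y : S y <= c / k * E y.
  by apply: ler_wpM2l => //; rewrite /E; have := expR_gt0 (- k * y); lra.
have SE' y : - S y <= c / k * E y.
  rewrite /S -mulrN; apply: ler_wpM2l => //.
  by rewrite /E; have := expR_gt0 (k * y); lra.
rewrite ler_norml; have [x0|/ltW x0] := leP 0 x.
- have := deriv_ge0_le x0 (fun y _ => d1 y) (fun y _ => p1 y).
  have := deriv_ge0_le x0 (fun y _ => d2 y) (fun y _ => p2 y).
  rewrite FG0 S0 !subrr addr0.
  by have := SE x => *; apply/andP; split; lra.
- have := deriv_ge0_le x0 (fun y _ => d1 y) (fun y _ => p1 y).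
  have := deriv_ge0_le x0 (fun y _ => d2 y) (fun y _ => p2 y).
  rewrite FG0 S0 !subrr addr0.
  by have := SE' x => *; apply/andP; split; lra.
Qed.

End Existence.

Section SolutionExists.
Context {R : realType}.
Implicit Types (u v w q : R -> R) (x y z : R).

Lemma continuous_of_halves (s : nat -> R -> R) u (c : R -> R) :
  (forall n, continuous (s n)) -> continuous c ->
  (forall n x, `|u x - s n x| <= c x / 2 ^+ n) -> continuous u.
Proof.
move=> cs cc h x; apply/cvgrPdist_le => /= e e0.
have e3 : 0 < e / 3 by rewrite divr_gt0.
have [n hn] := halves_small (c x + 1) e3.
have n0 : 0 < 2 ^+ n :> R by rewrite exprn_gt0.
near=> y.
have sxy : `|s n x - s n y| <= e / 3.
  by near: y; apply: cvgr_dist_le => //; exact: cs.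
have cxy : `|c x - c y| <= 1.
  by near: y; apply: cvgr_dist_le => //; exact: cc.
have cy : c y / 2 ^+ n <= e / 3.
  apply: le_trans hn; rewrite ler_pM2r ?invr_gt0//.
  by move: cxy; rewrite ler_norml => /andP[]; lra.
have cx : c x / 2 ^+ n <= e / 3.
  by apply: le_trans hn; rewrite ler_pM2r ?invr_gt0//; lra.
have := h n x; have := h n y => hy hx.
have := le_trans hy cy; have := le_trans hx cx.
move: sxy; rewrite !ler_norml => /andP[? ?] /andP[? ?] /andP[? ?].
by apply/andP; split; lra.
Unshelve. all: by end_near. Qed.

Let antiderivative_op : exists I : (R -> R) -> R -> R, forall f, continuous f ->
  I f 0 = 0 /\ forall x, is_derive x 1 (I f) (f x).
Proof.
have h (f : R -> R) : exists F : R -> R, continuous f ->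
    F 0 = 0 /\ forall x, is_derive x 1 F (f x).
  have [cf|ncf] := pselect (continuous f); last by exists f.
  by have [F hF] := antiderivative_exists cf; exists F.
by have [I hI] := choice h; exists I.
Qed.

(** Picard iteration for [u = al + I (be + I (q u))], where [I] integrates from
    [0]. For [k = 2 M + 1] the right-hand side halves distances in the weighted
    norm, so the iterates converge on the whole line at once. *)
Theorem solution_exists q (M al be : R) : continuous q ->
  (forall x, `|q x| <= M) ->
  exists u v, [/\ solution setT q u v, u 0 = al & v 0 = be].
Proof.
move=> cq qM.
have M0 : 0 <= M := le_trans (normr_ge0 _) (qM 0).
pose k := 2 * M + 1.
have k1 : 1 <= k by rewrite /k; lra.
have k0 : 0 < k by lra.
have kM : M / k / k <= 1 / 2.
  by rewrite !ler_pdivrMr// /k; nra.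
pose E (x : R) := expR (k * x) + expR (- k * x).
have E0 x : 0 < E x by rewrite addr_gt0 ?expR_gt0.
have cE : continuous E.
  exact: (isderive_continuous (fun x => isderiveD (isderive_expR k x) (isderive_expR (- k) x))).
have [I hI] := antiderivative_op.
pose T1 u x := be + I (fun y => q y * u y) x.
pose T u x := al + I (T1 u) x.
have cqu u : continuous u -> continuous (fun y => q y * u y).
  by move=> cu x; apply: continuousM; [exact: cq|exact: cu].
have dT1 u x : continuous u -> is_derive x 1 (T1 u) (q x * u x).
  move=> /cqu/hI[_ d].
  by apply: (is_derive_eq (isderiveD (is_derive_cst be x 1) (d x))); rewrite add0r.
have cT1 u : continuous u -> continuous (T1 u).
  by move=> cu; apply: (isderive_continuous (fun x => dT1 u x cu)).
have dT u x : continuous u -> is_derive x 1 (T u) (T1 u x).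
  move=> /cT1/hI[_ d].
  by apply: (is_derive_eq (isderiveD (is_derive_cst al x 1) (d x))); rewrite add0r.
have cT u : continuous u -> continuous (T u).
  by move=> cu; apply: (isderive_continuous (fun x => dT u x cu)).
have T10 u : continuous u -> T1 u 0 = be.
  by move=> /cqu/hI[e _]; rewrite /T1 e addr0.
have T0 u : continuous u -> T u 0 = al.
  by move=> /cT1/hI[e _]; rewrite /T e addr0.
(* two integrations gain k ^- 2, and M * k ^- 2 <= 1 / 2 *)
have contr u w (c : R) : 0 <= c -> continuous u -> continuous w ->
    (forall x, `|u x - w x| <= c * E x) ->
    forall x, `|T u x - T w x| <= c / 2 * E x.
  move=> c0 cu cw h x.
  have h1 y : `|T1 u y - T1 w y| <= M * c / k * E y.
    apply: (@antiderivative_dist _ k k0 (fun y => q y * u y) (fun y => q y * w y)).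
    - by rewrite !T10.
    - by move=> z; exact: dT1.
    - by move=> z; exact: dT1.
    - move=> z; rewrite -mulrBr normrM -mulrA; exact: ler_pM.
  have e0 : T u 0 = T w 0 by rewrite !T0.
  have h2 := @antiderivative_dist _ k k0 (T1 u) (T1 w) (T u) (T w) _ e0
     (fun y => dT u y cu) (fun y => dT w y cw) h1 x.
  apply: (le_trans h2).
  rewrite ler_pM2r; last exact: E0.
  have -> : M * c / k / k = c * (M / k / k) by ring.
  by apply: ler_wpM2l => //; move: kM; rewrite div1r.
pose s n := iter n T (cst 0).
have cs n : continuous (s n).
  by elim: n => [|n ih]; [exact: cst_continuous|exact: cT].
pose B := `|al| + `|be|.
have B0 : 0 <= B by rewrite addr_ge0.
have s1 x : `|s 1 x - s 0 x| <= B * E x.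
  have c0 : continuous (cst 0 : R -> R) by exact: cst_continuous.
  have e1 y : T1 (cst 0) y = be.
    have e : T1 (cst 0) 0 = (cst be : R -> R) 0 by rewrite T10.
    have d0 z : is_derive z 1 (T1 (cst 0)) 0.
      by apply: (is_derive_eq (dT1 (cst 0) z c0)); rewrite mulr0.
    have b z : `|(cst 0 : R -> R) z - (cst 0 : R -> R) z| <= 0 * (expR (k * z) + expR (- k * z)).
      by rewrite subrr normr0 mul0r.
    have := @antiderivative_dist _ k k0 (cst 0) (cst 0) (T1 (cst 0)) (cst be)
      0 e d0 (fun z => is_derive_cst be z 1) b y.
    by rewrite !mul0r normr_le0 subr_eq0 => /eqP.
  have E1 z : 1 <= E z.
    rewrite /E mulNr expRN.
    have p := expR_gt0 (k * z).
    have [ge1|/ltW le1] := leP 1 (expR (k * z)).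
      have : 0 <= (expR (k * z))^-1 by rewrite invr_ge0 ltW.
      lra.
    have : 1 <= (expR (k * z))^-1 by rewrite invf_ge1.
    lra.
  have h : `|T (cst 0) x - al| <= `|be| / k * E x.
    have e : T (cst 0) 0 = (cst al : R -> R) 0 by rewrite T0.
    have b z : `|T1 (cst 0) z - (cst 0 : R -> R) z| <= `|be| * (expR (k * z) + expR (- k * z)).
      by rewrite e1 subr0 ler_peMr//; exact: E1.
    exact: (@antiderivative_dist _ k k0 (T1 (cst 0)) (cst 0) (T (cst 0)) (cst al)
      `|be| e (fun z => dT _ z c0) (fun z => is_derive_cst al z 1) b x).
  rewrite /s /= subr0.
  rewrite -(subrK al (T (cst 0) x)); apply: (le_trans (ler_normD _ _)).
  rewrite /B mulrDl addrC lerD//.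
    by rewrite ler_peMr.
  apply: (le_trans h); rewrite ler_pM2r// ler_pdivrMr// ler_peMr//.
have sn n x : `|s n.+1 x - s n x| <= B / 2 ^+ n * E x.
  elim: n x => [|n ih] x; first by rewrite expr0 divr1; exact: s1.
  have -> : B / 2 ^+ n.+1 = B / 2 ^+ n / 2.
    by rewrite exprSr invfM mulrA.
  apply: (contr (s n.+1) (s n)) => //.
  by rewrite divr_ge0// exprn_ge0.
have lim x : exists l, forall n, `|l - s n x| <= 2 * B * E x / 2 ^+ n.
  apply: sum_of_halves => n; apply: (le_trans (sn n x)).
  rewrite exprS invfM.
  by rewrite (_ : 2 * B * E x * _ = B / 2 ^+ n * E x)//; field.
have [u hu] := choice lim.
have cu : continuous u.
  apply: (@continuous_of_halves s u (fun x => 2 * B * E x)) => // x.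
  by apply: (@continuousM _ _ (cst (2 * B)) E x); [exact: cst_continuous|exact: cE].
have Tu : T u = u.
  apply/funext => x; apply/eqP; rewrite -subr_eq0; apply/eqP.
  apply: (@halves_eq0 _ _ (2 * B * E x)) => n.
  have h1 : `|T u x - T (s n) x| <= 2 * B / 2 ^+ n / 2 * E x.
    apply: contr => //; first by rewrite divr_ge0 ?exprn_ge0// mulr_ge0.
    by move=> y; apply: (le_trans (hu y n)); rewrite mulrAC.
  have h2 := hu x n.+1.
  have -> : T u x - u x = (T u x - T (s n) x) - (u x - s n.+1 x).
    by rewrite /s /=; ring.
  apply: (le_trans (ler_normB _ _)).
  have h3 : 2 * B * E x / 2 ^+ n.+1 = 2 * B * E x / 2 ^+ n / 2.
    by rewrite exprSr invfM mulrA.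
  have h4 : 2 * B / 2 ^+ n / 2 * E x = 2 * B * E x / 2 ^+ n / 2 by ring.
  move: h1 h2; rewrite h3 h4; lra.
exists u, (T1 u); split; last 2 first.
- by rewrite -Tu T0.
- exact: T10.
- by move=> x _; split; [rewrite -{1}Tu; exact: dT|exact: dT1].
Qed.

End SolutionExists.

(** * Uniqueness and dependence on the spectral parameter *)

Section Linear.
Context {R : realType}.
Implicit Types (u v w q : R -> R) (x y z : R) (D : set R).

Lemma solution_sub D D' q u v : D' `<=` D -> solution D q u v ->
  solution D' q u v.
Proof. by move=> DD s x /DD; exact: s. Qed.

Lemma solution_lin D q u v u' v' (a b : R) :
  solution D q u v -> solution D q u' v' ->
  solution D q (fun x => a * u x + b * u' x) (fun x => a * v x + b * v' x).
Proof.
move=> s s' x Dx; have [du dv] := s _ Dx; have [du' dv'] := s' _ Dx; split.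
  exact: isderiveD (isderiveZ a du) (isderiveZ b du').
by apply: (is_derive_eq (isderiveD (isderiveZ a dv) (isderiveZ b dv'))); ring.
Qed.

Lemma solution_reflect D q u v : (forall x, D x -> D (- x)) ->
  solution D q u v ->
  solution D (fun x => q (- x)) (fun x => u (- x)) (fun x => - v (- x)).
Proof.
move=> DN s x Dx; have [du dv] := s _ (DN _ Dx); split.
  exact: isderive_reflect.
by apply: (is_derive_eq (isderiveN (@isderive_reflect _ v (fun y => q y * u y) x dv))); rewrite /= opprK.
Qed.

(** The energy is zero at [0], hence stays zero to the right of [0]; the left
    half is the same statement for the reflected equation. *)
Lemma solution_eq0 q u v (M x : R) : (forall y, `|q y| <= M) ->
  solution [set y | `|y| <= `|x|] q u v -> u 0 = 0 -> v 0 = 0 ->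
  u x = 0 /\ v x = 0.
Proof.
move=> qM s u0 v0.
have pos q' u' v' b : (forall y, `|q' y| <= M) -> 0 <= b -> b <= `|x| ->
    solution [set y | `|y| <= `|x|] q' u' v' -> u' 0 = 0 -> v' 0 = 0 ->
    u' b = 0 /\ v' b = 0.
  move=> q'M b0 bx s' u'0 v'0.
  have sb : solution [set y | 0 <= y <= b] q' u' v'.
    apply: solution_sub s' => y /= /andP[y0 yb].
    by rewrite ger0_norm//; exact: le_trans bx.
  have := @energy_bound _ q' u' v' M 0 b b0 (fun y _ => q'M y) sb.
  rewrite u'0 v'0 expr0n /= addr0 mul0r => h.
  have h1 := sqr_ge0 (u' b); have h2 := sqr_ge0 (v' b).
  split; apply/eqP; rewrite -sqrf_eq0; apply/eqP; lra.
have [x0|/ltW x0] := leP 0 x.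
  by apply: pos s u0 v0 => //; exact: ler_norm.
have [||||||] := pos (fun y => q (- y)) (fun y => u (- y)) (fun y => - v (- y)) (- x).
- by move=> y; exact: qM.
- by rewrite oppr_ge0.
- by rewrite -normrN ler_norm.
- by apply: solution_reflect => // y /=; rewrite normrN.
- by rewrite oppr0.
- by rewrite oppr0 v0 oppr0.
by rewrite opprK => -> /eqP; rewrite oppr_eq0 => /eqP.
Qed.

End Linear.

Section Family.
Context {R : realType}.
Implicit Types (x y z s t : R).

Variables (W : R -> R) (M : R).
Hypotheses (cW : continuous W) (WM : forall x, `|W x| <= M).

Let WtM t y : `|W y - t| <= M + `|t|.
Proof. by apply: (le_trans (ler_normB _ _)); rewrite lerD2r. Qed.

Definition solution_family (u v : R -> R -> R) (al be : R) : Prop :=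
  forall t, [/\ solution setT (fun x => W x - t) (u t) (v t),
    u t 0 = al & v t 0 = be].

Lemma solution_family_exists al be : exists u v, solution_family u v al be.
Proof.
have h t : exists uv : (R -> R) * (R -> R),
    [/\ solution setT (fun x => W x - t) uv.1 uv.2, uv.1 0 = al & uv.2 0 = be].
  have cWt : continuous (fun x => W x - t).
    by move=> x; apply: continuousB; [exact: cW|exact: cst_continuous].
  by have [u [v huv]] := solution_exists al be cWt (WtM t); exists (u, v).
have [uv huv] := choice h.
by exists (fun t => (uv t).1), (fun t => (uv t).2) => t; exact: huv.
Qed.

(** The difference [d] of two members solves
    [d'' = (W - t) d + (s - t) u] with zero data. The energy of [d] therefore
    obeys an inequality [e' <= k e + (t - s) ^+ 2 B], and Gronwall applies to
    [e + (t - s) ^+ 2 B / k]. *)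
Lemma solution_family_lipschitz u v al be (r L : R) : solution_family u v al be ->
  exists2 K, 0 <= K & forall s t x, `|s| <= L -> `|t| <= L -> 0 <= x <= r ->
    `|u t x - u s x| <= K * `|t - s| /\ `|v t x - v s x| <= K * `|t - s|.
Proof.
move=> fam.
pose e0 := al ^+ 2 + be ^+ 2.
have e00 : 0 <= e0 by rewrite addr_ge0 ?sqr_ge0.
pose k := 2 + M + `|L|.
have M0 : 0 <= M := le_trans (normr_ge0 _) (WM 0).
have k0 : 0 < k by rewrite /k; have := normr_ge0 L; lra.
pose B := e0 * expR (k * `|r|).
have B0 : 0 <= B by rewrite mulr_ge0 ?expR_ge0.
pose A := B * expR (k * `|r|).
have A0 : 0 <= A by rewrite mulr_ge0 ?expR_ge0.
exists (Num.sqrt (A / k)); first exact: sqrtr_ge0.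
move=> s t x sL tL /andP[x0 xr].
have sL' : `|s| <= `|L| := le_trans sL (ler_norm L).
have tL' : `|t| <= `|L| := le_trans tL (ler_norm L).
have [ss us vs] := fam s; have [st ut vt] := fam t.
have us2 y : 0 <= y <= x -> u s y ^+ 2 <= B.
  move=> /andP[y0 yx].
  have := @energy_bound _ _ _ _ _ 0 y y0 (fun z _ => WtM s z)
    (solution_sub (@subsetT _ _) ss).
  rewrite us vs subr0 => h.
  have h1 : expR ((1 + (M + `|s|)) * y) <= expR (k * `|r|).
    rewrite ler_expR ler_pM//; first by rewrite !addr_ge0.
      by rewrite /k; lra.
    by apply: (le_trans yx); apply: (le_trans xr); exact: ler_norm.
  have h2 : u s y ^+ 2 <= u s y ^+ 2 + v s y ^+ 2 by rewrite lerDl sqr_ge0.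
  apply: (le_trans h2); apply: (le_trans h); exact: ler_wpM2l.
pose d y := u t y - u s y; pose d' y := v t y - v s y.
pose D := (t - s) ^+ 2.
have D0 : 0 <= D by apply: sqr_ge0.
have := @gronwall _ (fun y => d y * d y + d' y * d' y + D * B / k)
  (fun y => 2 * (d y * d' y) + 2 * (d' y * ((W y - t) * d y + (s - t) * u s y)))
  k 0 x x0 _ _.
move=> hg.
have {}hg : d x * d x + d' x * d' x + D * B / k <=
   (d 0 * d 0 + d' 0 * d' 0 + D * B / k) * expR (k * (x - 0)).
  apply: hg => y yx.
    have [sty stv] := st y I; have [ssy ssv] := ss y I.
    have h1 := isderiveB sty ssy; have h2 := isderiveB stv ssv.
    apply: (is_derive_eq (isderiveD (isderiveD (isderiveM h1 h1) (isderiveM h2 h2)) (is_derive_cst _ y 1))).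
    by rewrite /d /d'; ring.
  have -> : k * (d y * d y + d' y * d' y + D * B / k) =
     k * (d y * d y + d' y * d' y) + D * B by field; rewrite gt_eqF.
  have := us2 y yx; set U := u s y => hU.
  set p := d y; set p' := d' y.
  have := le_trans (WtM t y) (_ : _ <= M + `|L|); rewrite lerD2l.
  move=> /(_ tL'); set Q := W y - t; rewrite ler_norml => /andP[q1 q2].
  have i1 : 2 * ((s - t) * (p' * U)) <= p' ^+ 2 + D * B.
    have a1 : 0 <= (p' - (s - t) * U) ^+ 2 by apply: sqr_ge0.
    have a2 : ((s - t) * U) ^+ 2 <= D * B.
      rewrite exprMn; have -> : (s - t) ^+ 2 = D by rewrite /D; ring.
      exact: ler_wpM2l.
    have -> : 2 * ((s - t) * (p' * U)) =
      p' ^+ 2 + ((s - t) * U) ^+ 2 - (p' - (s - t) * U) ^+ 2 by ring.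
    lra.
  have b1 : 0 <= (p + p') ^+ 2 by apply: sqr_ge0.
  have b2 : 0 <= (p - p') ^+ 2 by apply: sqr_ge0.
  have c1 : 0 <= (M + `|L| - Q) * (p + p') ^+ 2 by apply: mulr_ge0 => //; lra.
  have c2 : 0 <= (M + `|L| + Q) * (p - p') ^+ 2 by apply: mulr_ge0 => //; lra.
  have c3 : 0 <= p ^+ 2 by apply: sqr_ge0.
  have i2 : 2 * (p * p') * (1 + Q) <= (1 + M + `|L|) * (p * p + p' * p').
    rewrite -subr_ge0.
    have -> : (1 + M + `|L|) * (p * p + p' * p') - 2 * (p * p') * (1 + Q) =
      ((M + `|L| - Q) * (p + p') ^+ 2 + (M + `|L| + Q) * (p - p') ^+ 2) / 2
        + (p - p') ^+ 2 by field.
    by rewrite addr_ge0// divr_ge0// addr_ge0.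
  have -> : 2 * (p * p') + 2 * (p' * (Q * p + (s - t) * U)) =
    2 * (p * p') * (1 + Q) + 2 * ((s - t) * (p' * U)) by ring.
  have -> : k * (p * p + p' * p') + D * B = (1 + M + `|L|) * (p * p + p' * p') +
     p ^+ 2 + (p' ^+ 2 + D * B) by rewrite /k; ring.
  lra.

have e1 : d 0 = 0 by rewrite /d us ut subrr.
have e2 : d' 0 = 0 by rewrite /d' vs vt subrr.
move: hg; rewrite -!expr2 e1 e2 expr0n /= ?mulr0 !add0r subr0 => hg.
have DBk : 0 <= D * B / k by apply: divr_ge0; [exact: mulr_ge0|exact: ltW].
have h1 : expR (k * x) <= expR (k * `|r|).
  by rewrite ler_expR ler_pM2l//; apply: (le_trans xr); exact: ler_norm.
have hAk : d x ^+ 2 + d' x ^+ 2 <= A / k * D.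
  have -> : A / k * D = D * B / k * expR (k * `|r|) by rewrite /A; ring.
  have := ler_wpM2l DBk h1; rewrite !expr2; lra.
have Ak : 0 <= A / k by rewrite divr_ge0// ltW.
have fin (z : R) : z ^+ 2 <= A / k * D -> `|z| <= Num.sqrt (A / k) * `|t - s|.
  by move=> h; rewrite -!sqrtr_sqr -sqrtrM// ler_sqrt// mulr_ge0.
split; apply: fin.
  by apply: le_trans hAk; rewrite lerDl sqr_ge0.
by apply: le_trans hAk; rewrite lerDr sqr_ge0.
Qed.

Lemma lipschitz_continuous (f : R -> R) :
  (forall L, exists2 K, 0 <= K & forall s t, `|s| <= L -> `|t| <= L ->
     `|f t - f s| <= K * `|t - s|) -> continuous f.
Proof.
move=> h t; have [K K0 hK] := h (`|t| + 1).
apply/cvgrPdist_le => /= e e0.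
have K1 : 0 < K + 1 by rewrite ltr_wpDl.
have eK : 0 < e / (K + 1) by apply: divr_gt0.
near=> s.
have st : `|t - s| <= 1.
  by near: s; apply: cvgr_dist_le => //; exact: cvg_id.
have st2 : `|t - s| <= e / (K + 1).
  by near: s; apply: cvgr_dist_le => //; exact: cvg_id.
have sL : `|s| <= `|t| + 1.
  by rewrite -(subrK t s) addrC (le_trans (ler_normD _ _))// lerD2l distrC.
apply: (le_trans (hK _ _ sL _)); first by rewrite lerDl.
move: st2; rewrite ler_pdivlMr// => h2.
by apply: le_trans h2; rewrite mulrC ler_wpM2l// lerDl.
Unshelve. all: by end_near. Qed.

End Family.

(** * Monotone functions integrated against a derivative *)

Section Monotone.
Context {R : realType}.
Implicit Types (f g F G H P : R -> R) (a b c k m p q x y z s t : R).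

Lemma continuous_le_end F a b c : continuous F -> a < b ->
  (forall x, a < x < b -> F x <= c) -> F a <= c /\ F b <= c.
Proof.
move=> cF ab h; split; rewrite leNgt; apply/negP => hc.
- have cFa : F x @[x --> a^'+] --> F a by apply: cvg_at_right_filter; exact: cF.
  near a^'+ => x.
  have : F x <= c by apply: h; apply/andP; split; near: x;
    [exact: nbhs_right_gt|exact: nbhs_right_lt].
  rewrite leNgt => /negP; apply; near: x.
  exact: (cvgr_gt (F a)).
- have cFb : F x @[x --> b^'-] --> F b by apply: cvg_at_left_filter; exact: cF.
  near b^'- => x.
  have : F x <= c by apply: h; apply/andP; split; near: x;
    [exact: nbhs_left_gt|exact: nbhs_left_lt].
  rewrite leNgt => /negP; apply; near: x.
  exact: (cvgr_gt (F b)).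
Unshelve. all: by end_near. Qed.

(** A long step is a composition of short ones. *)
Lemma nonincreasing_of_steps F a b d : 0 < d ->
  (forall x y, a <= x -> x <= y -> y <= b -> y - x <= d -> F y <= F x) ->
  forall x y, a <= x -> x <= y -> y <= b -> F y <= F x.
Proof.
move=> d0 h x y ax xy yb.
have [n hn] : exists n : nat, y - x <= n%:R * d.
  exists (Num.trunc `|(y - x) / d|).+1.
  rewrite -ler_pdivrMr//; apply: le_trans (ler_norm _) _.
  exact/ltW/truncnS_gt.
elim: n => [|n ih] in y xy yb hn *.
  have -> : y = x by apply/eqP; rewrite eq_le xy andbT -subr_le0; rewrite mul0r in hn.
  by [].
have [yd|yd] := leP (y - x) d; first exact: h.
have h1 : F (y - d) <= F x.
  apply: ih; [lra|lra|].
  by move: hn; rewrite -natr1 mulrDl mul1r; lra.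
apply: le_trans h1; apply: h; lra.
Qed.

(** Formally [(H - P g)' = - P' g <= 0]. With [P] only continuous,
    compare values at two near points instead: by the mean value theorem
    [H - P y * g] varies by at most [C (P y - P x) (y - x)] between [x] and [y],
    which is beaten by the jump [(P y - P x) g x] as soon as [y - x] is small
    compared with the minimum of [g]. This is why the argument is first made
    on compact subintervals of [(0, b)]. *)
Lemma integration_sign_change H g g' P b : 0 < b ->
  (forall x, is_derive x 1 H (P x * g' x)) ->
  (forall x, is_derive x 1 g (g' x)) ->
  continuous g' -> continuous P ->
  (forall x y, 0 <= x -> x <= y -> y <= b -> P x <= P y) ->
  (forall x, 0 < x < b -> 0 < g x) ->
  P 0 < P b -> H b - P b * g b < H 0 - P 0 * g 0.
Proof.
move=> b0 dH dg cg' cP Pmono gpos P0b.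
pose G x := H x - P x * g x.
have cg := isderive_continuous dg; have cH := isderive_continuous dH.
have cG : continuous G.
  move=> x; apply: (@continuousB _ _ _ H (fun x => P x * g x) x); first exact: cH.
  by apply: (@continuousM _ _ P g x); [exact: cP|exact: cg].
have [k0 _ hk] : exists2 k, k \in `[0, b] & forall t, t \in `[0, b] -> `|g' t| <= `|g' k|.
  apply: (@EVT_max _ (fun x => `|g' x|)); first exact: ltW.
  apply: continuous_subspaceT => x; apply: continuous_comp; first exact: cg'.
  exact: norm_continuous.
pose C := `|g' k0|.
have C0 : 0 <= C by exact: normr_ge0.
have step x y : 0 <= x -> x <= y -> y <= b ->
    G y - G x <= (P y - P x) * (C * (y - x) - g x).
  move=> x0 xy yb.
  have dK z : is_derive z 1 (fun z => H z - P y * g z) ((P z - P y) * g' z).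
    by apply: (is_derive_eq (isderiveB (dH z) (isderiveZ (P y) (dg z)))); ring.
  have [z /andP[xz zy] e] := mean_value xy (fun z _ => dK z).
  have -> : G y - G x = (H y - P y * g y - (H x - P y * g x)) - (P y - P x) * g x.
    by rewrite /G; ring.
  rewrite e [leRHS]mulrBr lerB// [leRHS]mulrA.
  apply: ler_wpM2r; first by rewrite subr_ge0.
  have hz : `|g' z| <= C.
    by apply: hk; rewrite in_itv /=; apply/andP; split; lra.
  have p1 : P x <= P z by apply: Pmono; lra.
  have p2 : P z <= P y by apply: Pmono; lra.
  apply: (@le_trans _ _ ((P y - P z) * C)).
    have -> : (P z - P y) * g' z = (P y - P z) * (- g' z) by ring.
    apply: ler_wpM2l; first by rewrite subr_ge0.
    by apply: le_trans hz; rewrite -normrN ler_norm.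
  by apply: ler_wpM2r => //; lra.
(* the surplus k P measures the strict decrease of G *)
have decr p q : 0 < p -> p <= q -> q < b -> exists2 k, 0 < k &
    forall x y, p <= x -> x <= y -> y <= q -> G y + k * P y <= G x + k * P x.
  move=> p0 pq qb.
  have [m mpq hm] : exists2 m, m \in `[p, q] & forall t, t \in `[p, q] -> g m <= g t.
    by apply: EVT_min => //; exact: continuous_subspaceT.
  have gm : 0 < g m.
    by move: mpq; rewrite in_itv /= => /andP[? ?]; apply: gpos; apply/andP; split; lra.
  have gm2 : 0 < g m / 2 by rewrite divr_gt0.
  have C1 : 0 < C + 1 by lra.
  exists (g m / 2) => // x y px xy yq.
  apply: (@nonincreasing_of_steps (fun x => G x + g m / 2 * P x) p q
     (g m / 2 / (C + 1))) => //; first by rewrite divr_gt0.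
  move=> {px xy yq} {}x {}y px xy yq; rewrite ler_pdivlMr// => hd.
  have hs := step x y (ltW (lt_le_trans p0 px)) xy (le_trans yq (ltW qb)).
  have hg : g m <= g x by apply: hm; rewrite in_itv /= px (le_trans xy yq).
  have hP : 0 <= P y - P x by rewrite subr_ge0; apply: Pmono; lra.
  have h1 : C * (y - x) <= g m / 2 by lra.
  have : 0 <= (P y - P x) * (g x - C * (y - x) - g m / 2) by apply: mulr_ge0 => //; lra.
  lra.
have cP0 : P x @[x --> 0^'+] --> P 0 by apply: cvg_at_right_filter; exact: cP.
have cPb : P x @[x --> b^'-] --> P b by apply: cvg_at_left_filter; exact: cP.
have mid1 : P 0 < (P 0 + P b) / 2 by lra.
have mid2 : (P 0 + P b) / 2 < P b by lra.
have [p [p0 pb hp]] : exists p, [/\ 0 < p, p < b & P p < (P 0 + P b) / 2].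
  near (0 : R)^'+ => p; exists p; split => //.
  by near: p; exact: (cvgr_lt (P 0)).
have [q [q0 qb hq]] : exists p, [/\ 0 < p, p < b & (P 0 + P b) / 2 < P p].
  near b^'- => q; exists q; split => //.
  by near: q; exact: (cvgr_gt (P b)).
have pq : p < q.
  rewrite ltNge; apply/negP => qp; have : P q <= P p by apply: Pmono; lra.
  lra.
have [k k_gt0 hk1] := decr p q p0 (ltW pq) qb.
have Gpq : G q < G p.
  have h1 := hk1 p q (lexx _) (ltW pq) (lexx _).
  have : 0 < k * (P q - P p) by apply: mulr_gt0 => //; lra.
  lra.
have Gmono x y : 0 < x -> x <= y -> y < b -> G y <= G x.
  move=> x0 xy yb; have [l l0 hl] := decr x y x0 xy yb.
  have := hl x y (lexx _) xy (lexx _).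
  have : 0 <= l * (P y - P x).
    by apply: mulr_ge0; [exact: ltW|rewrite subr_ge0; apply: Pmono; lra].
  lra.
have [_ Gb] : G q <= G q /\ G b <= G q.
  apply: continuous_le_end => // x /andP[qx xb]; apply: Gmono => //; exact: ltW.
have [G0 _] : - G 0 <= - G p /\ - G p <= - G p.
  apply: (@continuous_le_end (fun x => - G x)) => //.
    by move=> x; apply: continuousN; exact: cG.
  by move=> x /andP[x0 xp]; rewrite lerN2; apply: Gmono => //; exact: ltW.
rewrite lerN2 in G0.
exact: le_lt_trans Gb (lt_le_trans Gpq G0).
Unshelve. all: by end_near. Qed.

End Monotone.

(** * The even and the odd solution *)

Section Comparison.
Context {R : realType}.
Implicit Types (a b m p q s t x y z : R).

Lemma ivt_zero (f : R -> R) a b : continuous f -> a <= b -> f a <= 0 <= f b ->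
  exists2 z, a <= z <= b & f z = 0.
Proof.
move=> cf ab /andP[fa fb].
have [|z zab fz] := @IVT R f a b 0 ab (continuous_subspaceT cf).
  by rewrite ge_min fa le_max fb orbT.
by exists z.
Qed.

Variables (W : R -> R) (M : R).
Hypotheses (cW : continuous W) (WM : forall x, `|W x| <= M)
  (Weven : forall x, W (- x) = W x).

Variables (C C' S S' : R -> R -> R).
Hypotheses (famC : solution_family W C C' 1 0) (famS : solution_family W S S' 0 1).

Let qM t y : `|W y - t| <= M + `|t|.
Proof. by apply: (le_trans (ler_normB _ _)); rewrite lerD2r. Qed.

Let solC t : solution setT (fun x => W x - t) (C t) (C' t).
Proof. by have [] := famC t. Qed.
Let solS t : solution setT (fun x => W x - t) (S t) (S' t).
Proof. by have [] := famS t. Qed.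
Let C0 t : C t 0 = 1. Proof. by have [] := famC t. Qed.
Let C'0 t : C' t 0 = 0. Proof. by have [] := famC t. Qed.
Let S0 t : S t 0 = 0. Proof. by have [] := famS t. Qed.
Let S'0 t : S' t 0 = 1. Proof. by have [] := famS t. Qed.
Let dC t x : is_derive x 1 (C t) (C' t x).
Proof. by have [] := @solC t x I. Qed.
Let dC' t x : is_derive x 1 (C' t) ((W x - t) * C t x).
Proof. by have [] := @solC t x I. Qed.
Let dS t x : is_derive x 1 (S t) (S' t x).
Proof. by have [] := @solS t x I. Qed.
Let dS' t x : is_derive x 1 (S' t) ((W x - t) * S t x).
Proof. by have [] := @solS t x I. Qed.
Let cC t : continuous (C t). Proof. exact: (isderive_continuous (@dC t)). Qed.
Let cC' t : continuous (C' t). Proof. exact: (isderive_continuous (@dC' t)). Qed.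
Let cS t : continuous (S t). Proof. exact: (isderive_continuous (@dS t)). Qed.
Let cS' t : continuous (S' t). Proof. exact: (isderive_continuous (@dS' t)). Qed.

(** Subtracting the combination with the same data at [0] leaves a solution with
    zero data. *)
Lemma solution_basis (r t : R) (u v : R -> R) :
  solution [set y | `|y| < r] (fun x => W x - t) u v ->
  forall x, `|x| < r ->
    u x = u 0 * C t x + v 0 * S t x /\ v x = u 0 * C' t x + v 0 * S' t x.
Proof.
move=> su x xr.
have su' : solution [set y | `|y| <= `|x|] (fun x => W x - t) u v.
  by apply: solution_sub su => y /= yx; exact: le_lt_trans xr.
have sCS := solution_lin (u 0) (v 0) (solC t) (solS t).
have := solution_lin 1 (-1) su' (solution_sub (@subsetT _ _) sCS).
move=> /(solution_eq0 (qM t)) /=.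
rewrite C0 S0 C'0 S'0 => h.
by have [||h1 h2] := h; [ring|ring|split; lra].
Qed.

Let reflect_solution t u v : solution setT (fun x => W x - t) u v ->
  solution setT (fun x => W x - t) (fun x => u (- x)) (fun x => - v (- x)).
Proof.
move=> /solution_reflect h x _.
by have := h (fun _ _ => I) x I; rewrite /= Weven.
Qed.

Lemma C_even t x : C t (- x) = C t x /\ C' t (- x) = - C' t x.
Proof.
have h := reflect_solution (solC t).
have [|e1 e2] := @solution_basis (`|x| + 1) t _ _ (solution_sub (@subsetT _ _) h) x.
  by rewrite ltrDl.
move: e1 e2; rewrite oppr0 C0 C'0 oppr0 !mul0r !mul1r !addr0 => -> <-.
by rewrite opprK.
Qed.

Lemma S_odd t x : S t (- x) = - S t x /\ S' t (- x) = S' t x.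
Proof.
have h := reflect_solution (solS t).
have [|e1 e2] := @solution_basis (`|x| + 1) t _ _ (solution_sub (@subsetT _ _) h) x.
  by rewrite ltrDl.
move: e1 e2; rewrite oppr0 S0 S'0 !mul0r !add0r !mulN1r => -> h2.
by split=> //; apply: oppr_inj.
Qed.

Lemma wronskian t x : C t x * S' t x - C' t x * S t x = 1.
Proof.
have d y : is_derive y 1 (fun y => C t y * S' t y - C' t y * S t y) 0.
  by apply: (is_derive_eq (isderiveB (isderiveM (dC t y) (dS' t y)) (isderiveM (dC' t y) (dS t y)))); ring.
rewrite (is_derive_0_is_cst x 0 d) C0 S'0 S0; ring.
Qed.

(** By the Wronskian identity [S / C] has derivative [C ^- 2]. *)
Lemma S_pos t b : 0 < b -> (forall x, 0 <= x <= b -> 0 < C t x) -> 0 < S t b.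
Proof.
move=> b0 Cpos.
have Cn0 x : 0 <= x <= b -> C t x != 0 by move=> /Cpos/gt_eqF ->.
have d x : 0 <= x <= b -> is_derive x 1 (fun y => S t y * (C t y)^-1) ((C t x) ^- 2).
  move=> xb; have dV := is_deriveV (Cn0 x xb) (dC t x).
  apply: (is_derive_eq (isderiveM (dS t x) dV)).
  rewrite /GRing.scale /=.
  have -> : S' t x * (C t x)^-1 + S t x * (- (C t x) ^- 2 * C' t x) =
    (C t x * S' t x - C' t x * S t x) * (C t x) ^- 2 by field; exact: Cn0.
  by rewrite wronskian mul1r.
have := deriv_gt0_lt b0 d _.
move=> /(_ _); rewrite S0 mul0r => h.
have : 0 < S t b * (C t b)^-1.
  by apply: h => x xb; rewrite invr_gt0 exprn_gt0// Cpos.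
by rewrite pmulr_lgt0// invr_gt0 Cpos// lexx ltW.
Qed.

(** For [t] below the range of [W] the solution is convex where it is positive:
    [C C'] is increasing, so [C ^+ 2 >= 1] and [C] cannot change sign. *)
Lemma low_energy_C t (r : R) : t <= - M - 1 -> 0 < r ->
  (forall x, 0 <= x <= r -> 0 < C t x) /\ 0 < C' t r.
Proof.
move=> tM r0.
have Wt x : 1 <= W x - t.
  by have := WM x; rewrite ler_norml => /andP[]; lra.
have d x : is_derive x 1 (fun y => C t y * C' t y)
    (C' t x ^+ 2 + (W x - t) * C t x ^+ 2).
  by apply: (is_derive_eq (isderiveM (dC t x) (dC' t x))); ring.
have d2 x : is_derive x 1 (fun y => C t y * C t y) (2 * (C t x * C' t x)).
  by apply: (is_derive_eq (isderiveM (dC t x) (dC t x))); ring.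
have CC' x : 0 <= x -> 0 <= C t x * C' t x.
  move=> x0; have := deriv_ge0_le x0 (fun y _ => d y) _.
  rewrite C0 C'0 mulr0; apply=> y _; apply: addr_ge0; first exact: sqr_ge0.
  by apply: mulr_ge0; [have := Wt y; lra|exact: sqr_ge0].
have C2 x : 0 <= x -> 1 <= C t x * C t x.
  move=> x0; have := deriv_ge0_le x0 (fun y _ => d2 y) _.
  rewrite C0 mulr1; apply=> y /andP[y0 _]; rewrite mulr_ge0//; exact: CC'.
have pos x : 0 <= x <= r -> 0 < C t x.
  move=> /andP[x0 xr]; rewrite ltNge; apply/negP => Cx.
  have cNC : continuous (fun y => - C t y) by move=> y; apply: continuousN; exact: cC.
  have [|z /andP[z0 zx] Cz] := ivt_zero cNC x0.
    by rewrite C0 oppr_ge0 Cx lerN10.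
  have := C2 z z0; move/eqP: Cz; rewrite oppr_eq0 => /eqP ->.
  by rewrite mul0r ler10.
split=> //.
have : 0 < C t r * C' t r.
  have := deriv_gt0_lt r0 (fun y _ => d y) _.
  rewrite C0 C'0 mulr0; apply=> y /andP[y0 _]; rewrite ltr_wpDl ?sqr_ge0// expr2.
  by apply: mulr_gt0; [have := Wt y|have := C2 y y0]; lra.
by rewrite pmulr_rgt0// pos// lexx ltW.
Qed.

(** At a zero [z > 0] of [S'] the strictly increasing function [S S'] would be
    back at its initial value [0]. *)
Lemma low_energy_S' t (r : R) : t <= - M - 1 -> 0 < r -> 0 < S' t r.
Proof.
move=> tM r0.
have Wt x : 1 <= W x - t.
  by have := WM x; rewrite ler_norml => /andP[]; lra.
have d x : is_derive x 1 (fun y => S t y * S' t y)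
    (S' t x ^+ 2 + (W x - t) * S t x ^+ 2).
  by apply: (is_derive_eq (isderiveM (dS t x) (dS' t x))); ring.
rewrite ltNge; apply/negP => Sx.
have cNS : continuous (fun y => - S' t y) by move=> y; apply: continuousN; exact: cS'.
have [|z /andP[z0 zx] Sz] := ivt_zero cNS (ltW r0).
  by rewrite S'0 oppr_ge0 Sx lerN10.
have {}Sz : S' t z = 0 by apply/eqP; rewrite -oppr_eq0 Sz.
have {}z0 : 0 < z.
  rewrite lt_neqAle z0 andbT; apply/eqP => z00.
  by move: Sz; rewrite -z00 S'0 => /eqP; rewrite oner_eq0.
have := deriv_gt0_lt z0 (fun y _ => d y) _.
rewrite Sz S0 mul0r mulr0 ltxx => h.
suff : false by []; apply: h => y _.
have := wronskian t y; have := Wt y.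
have h1 := sqr_ge0 (S t y); have h2 := sqr_ge0 (S' t y).
move=> h3 w.
have : 0 <= (W y - t - 1) * S t y ^+ 2 by apply: mulr_ge0 => //; lra.
move=> h4.
rewrite lt_neqAle; apply/andP; split; last by lra.
apply/eqP => e.
have e1 : S t y ^+ 2 = 0 by lra.
have e2 : S' t y ^+ 2 = 0 by lra.
move/eqP: e1; rewrite sqrf_eq0 => /eqP e1; move/eqP: e2; rewrite sqrf_eq0 => /eqP e2.
by move: w; rewrite e1 e2 !mulr0 subrr => /eqP; rewrite eq_sym oner_eq0.
Qed.

Variable r : R.
Hypothesis r0 : 0 < r.

Let min_C t : exists m, [/\ (forall x, 0 <= x <= r -> m <= C t x) &
  exists2 z, 0 <= z <= r & C t z = m].
Proof.
have [z zr hz] := EVT_min (ltW r0) (continuous_subspaceT (@cC t)).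
exists (C t z); split; last by exists z.
by move=> x xr; apply: hz.
Qed.

(** A nonnegative solution that touches zero has a double zero there, against
    the Wronskian identity. *)
Lemma interior_min_C t z : 0 < z < r -> C t z = 0 ->
  (forall x, 0 <= x <= r -> 0 <= C t x) -> False.
Proof.
move=> zr Cz h.
have d0 : is_derive z 1 (C t) 0.
  apply: (@derive1_at_min R (C t) 0 r z) => //; first exact: ltW.
    by move=> x _; case: (dC t x).
  move=> x; rewrite in_itv /= => /andP[x0 xr].
  by rewrite Cz; apply: h; rewrite !ltW.
have C'z : C' t z = 0.
  have e1 := @derive_val _ _ _ _ _ _ _ d0.
  by have := @derive_val _ _ _ _ _ _ _ (dC t z); rewrite e1.
have := wronskian t z; rewrite Cz C'z !mul0r subrr => /eqP.
by rewrite eq_sym oner_eq0.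
Qed.

Lemma C'_continuous : continuous (fun t => C' t r).
Proof.
apply: lipschitz_continuous => L.
have [K K0 hK] := solution_family_lipschitz WM r L famC.
by exists K => // s t sL tL; have [] := hK s t r sL tL; rewrite // ltW //= lexx.
Qed.

Lemma S'_continuous : continuous (fun t => S' t r).
Proof.
apply: lipschitz_continuous => L.
have [K K0 hK] := solution_family_lipschitz WM r L famS.
by exists K => // s t sL tL; have [] := hK s t r sL tL; rewrite // ltW //= lexx.
Qed.

(** Let [m t] be the minimum of [C t] over [[0, r]]. It is continuous in [t] and
    positive for very negative [t]. If [C t] is not positive on [[0, r)] then
    [m t <= 0], so [m] vanishes at some [t1 <= t]; the zero of [C t1] is not
    interior, hence [C t1 r = 0], and the hypothesis forces [t1 = t]. Then
    [C t >= 0], and a point of [[0, r)] where it is not positive is an interior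
    zero after all. *)
Lemma C_positive (l t : R) : (forall s, s < l -> C s r != 0) -> t <= l ->
  forall x, 0 <= x < r -> 0 < C t x.
Proof.
move=> hl tl x /andP[x0 xr]; rewrite ltNge; apply/negP => Cx.
have [m hm] := choice min_C.
have mlip L : exists2 K, 0 <= K & forall s t, `|s| <= L -> `|t| <= L ->
    `|m t - m s| <= K * `|t - s|.
  have [K K0 hK] := solution_family_lipschitz WM r L famC.
  exists K => // s t' sL tL.
  have [hs [zs zsr es]] := hm s; have [ht [zt ztr et]] := hm t'.
  have [+ _] := hK s t' zs sL tL zsr; have [+ _] := hK s t' zt sL tL ztr.
  rewrite es et !ler_norml.
  have := hs zt ztr; have := ht zs zsr => a1 a2 /andP[b1 b2] /andP[c1 c2].
  by apply/andP; split; lra.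
have cm : continuous (fun s => - m s).
  by move=> s; apply: continuousN; exact: lipschitz_continuous.
pose t0 := Num.min (- M - 1) t.
have t0t : t0 <= t by rewrite /t0 ge_min lexx orbT.
have [t1 /andP[t01 t1t] mt1] : exists2 z, t0 <= z <= t & - m z = 0.
  apply: ivt_zero => //; rewrite oppr_le0 oppr_ge0; apply/andP; split.
    have [_ [z zr <-]] := hm t0; apply: ltW.
    have t0M : t0 <= - M - 1 by rewrite /t0 ge_min lexx.
    by have [h _] := low_energy_C t0M r0; exact: h.
  by have [h _] := hm t; apply: le_trans Cx; apply: h; rewrite x0 ltW.
have {}mt1 : m t1 = 0 by apply/eqP; rewrite -oppr_eq0 mt1.
have [h1 [z /andP[z0 zr] Cz]] := hm t1; rewrite mt1 in Cz h1.
have {}z0 : 0 < z.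
  rewrite lt_neqAle z0 andbT; apply/eqP => e.
  by move: Cz; rewrite -e C0 => /eqP; rewrite oner_eq0.
have [zr'|zr'] := ltP z r.
  by apply: (@interior_min_C t1 z) => //; rewrite z0.
have {zr zr'} zr : z = r by apply/eqP; rewrite eq_le zr.
have t1l : l <= t1 by rewrite leNgt; apply/negP => /hl; rewrite -zr Cz eqxx.
have tt1 : t1 = t by apply/eqP; rewrite eq_le t1t (le_trans tl).
have Cx0 : C t x = 0.
  by apply/eqP; rewrite eq_le Cx -tt1 h1// x0 ltW.
apply: (@interior_min_C t x) => //; last by rewrite -tt1.
rewrite xr andbT lt_neqAle x0 andbT; apply/eqP => e.
by move: Cx0; rewrite -e C0 => /eqP; rewrite oner_eq0.
Qed.

Lemma C_end_ge0 t : (forall x, 0 <= x < r -> 0 < C t x) -> 0 <= C t r.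
Proof.
move=> h; have cN : continuous (fun x => - C t x).
  by move=> x; apply: continuousN; exact: cC.
have [|_] := @continuous_le_end _ (fun x => - C t x) 0 r 0 cN r0.
  by move=> x /andP[x0 xr]; rewrite oppr_le0 ltW// h// ltW.
by rewrite oppr_le0.
Qed.

Lemma S_pos_open t : (forall x, 0 <= x < r -> 0 < C t x) ->
  forall x, 0 < x < r -> 0 < S t x.
Proof.
move=> h x /andP[x0 xr]; apply: S_pos => // y /andP[y0 yx].
by apply: h; rewrite y0 (le_lt_trans yx).
Qed.

Lemma S_end_ge0 t : (forall x, 0 <= x < r -> 0 < C t x) -> 0 <= S t r.
Proof.
move=> h; have cN : continuous (fun x => - S t x).
  by move=> x; apply: continuousN; exact: cS.
have [|_] := @continuous_le_end _ (fun x => - S t x) 0 r 0 cN r0.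
  by move=> x xr; rewrite oppr_le0 ltW// S_pos_open.
by rewrite oppr_le0.
Qed.

(** If [S] vanished at [r], the Wronskian identity would give [C r <> 0], and
    [S_pos] would apply up to the end. *)
Lemma S_end_gt0 t : (forall x, 0 <= x < r -> 0 < C t x) -> 0 < S t r.
Proof.
move=> h; have := S_end_ge0 h; rewrite le_eqVlt => /predU1P[Sr|//].
apply: S_pos => // x /andP[x0]; rewrite le_eqVlt => /predU1P[->|xr].
  have := wronskian t r; rewrite -Sr mulr0 subr0 => w.
  rewrite lt_neqAle C_end_ge0// andbT; apply/eqP => e.
  by move: w; rewrite -e mul0r => /eqP; rewrite eq_sym oner_eq0.
by apply: h; rewrite x0.
Qed.

Let dH t x : is_derive x 1 (fun y => C' t y * S' t y)
  ((W x - t) * (C' t x * S t x + C t x * S' t x)).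
Proof. by apply: (is_derive_eq (isderiveM (dC' t x) (dS' t x))); ring. Qed.

Let dg t x : is_derive x 1 (fun y => C t y * S t y)
  (C' t x * S t x + C t x * S' t x).
Proof. exact: isderiveM (dC t x) (dS t x). Qed.

Let cg' t : continuous (fun x => C' t x * S t x + C t x * S' t x).
Proof.
move=> x; apply: (@continuousD _ _ _ (fun x => C' t x * S t x) (fun x => C t x * S' t x)).
  by apply: (@continuousM _ _ (C' t) (S t)); [exact: cC'|exact: cS].
by apply: (@continuousM _ _ (C t) (S' t)); [exact: cC|exact: cS'].
Qed.

Let cWt t : continuous (fun x => W x - t).
Proof. by move=> x; apply: continuousB; [exact: cW|exact: cst_continuous]. Qed.

(** Suppose [S' r = 0]. The sign of [C' S' - (W - t) C S] at [r] reads
    [0 < (W r - t) C r S r], impossible if [W r <= t]. Otherwise look at the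
    point [c] where [W c = t]: both solutions are convex on [[c, r]], so [C'] and
    [S'] are still nonpositive at [c] and [C' S' >= 0] there, again against the
    sign. *)
Lemma increasing_odd_neumann t :
  (forall x, 0 <= x < r -> 0 < C t x) ->
  (forall x y, 0 <= x -> x <= y -> y <= r -> W x <= W y) -> W 0 < W r ->
  S' t r != 0.
Proof.
move=> h Wmono W0r; apply/eqP => Sr'.
have Sr := S_end_gt0 h; have Cr := C_end_ge0 h.
have C'r : C' t r < 0.
  have := wronskian t r; rewrite Sr' mulr0 sub0r => w.
  by rewrite -(pmulr_llt0 _ Sr); lra.
have gpos b x : b <= r -> 0 < x < b -> 0 < C t x * S t x.
  move=> br /andP[x0 xb]; apply: mulr_gt0.
    by apply: h; rewrite ltW//=; lra.
  by apply: S_pos_open => //; rewrite x0; lra.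
have sc b : 0 < b -> b <= r -> W 0 < W b ->
    C' t b * S' t b - (W b - t) * (C t b * S t b) < 0.
  move=> b0 br W0b.
  have := @integration_sign_change _ _ _ _ (fun x => W x - t) b b0 (@dH t) (@dg t)
    (@cg' t) (@cWt t) _ _ _.
  rewrite C'0 S0 !mul0r !mulr0 subrr; apply.
  - by move=> x y x0 xy yb; rewrite lerD2r; apply: Wmono => //; lra.
  - by move=> x; exact: gpos.
  - by rewrite ltrD2r.
have [Wrt|tWr] := leP (W r) t.
  have := sc r r0 (lexx _) W0r; rewrite Sr' mulr0 sub0r oppr_lt0 => hh.
  have : 0 <= (t - W r) * (C t r * S t r).
    by apply: mulr_ge0; [lra|apply: mulr_ge0 => //; exact: ltW].
  lra.
have Spos x : 0 <= x -> x <= r -> 0 <= S t x.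
  rewrite le_eqVlt => /predU1P[<- _|x0]; first by rewrite S0.
  rewrite le_eqVlt => /predU1P[->|xr]; first exact: ltW.
  by apply/ltW/S_pos_open => //; rewrite x0.
have Cpos x : 0 <= x -> x <= r -> 0 <= C t x.
  move=> x0; rewrite le_eqVlt => /predU1P[->//|xr].
  by apply/ltW/h; rewrite x0.
have W0t : W 0 < t.
  rewrite ltNge; apply/negP => tW0.
  have := deriv_ge0_le (ltW r0) (fun y _ => dS' t y) _.
  rewrite Sr' S'0 ler10 => hh; suff : false by []; apply: hh => y /andP[y0 yr].
  apply: mulr_ge0; last exact: Spos.
  by have := Wmono 0 y (lexx _) y0 yr; lra.
have [|c /andP[c0 cr] Wc] := ivt_zero (@cWt t) (ltW r0); first by apply/andP; split; lra.
have {}c0 : 0 < c.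
  rewrite lt_neqAle c0 andbT; apply/eqP => e; move: Wc; rewrite -e; lra.
have := sc c c0 cr; rewrite Wc mul0r subr0.
have hW y : c <= y <= r -> 0 <= W y - t.
  by move=> /andP[cy yr]; rewrite -Wc lerD2r; apply: Wmono => //; lra.
have C'c : C' t c <= C' t r.
  apply: (deriv_ge0_le cr (fun y _ => dC' t y)) => y ycr.
  apply: mulr_ge0; first exact: hW.
  by move/andP: ycr => [? ?]; apply: Cpos => //; lra.
have S'c : S' t c <= S' t r.
  apply: (deriv_ge0_le cr (fun y _ => dS' t y)) => y ycr.
  apply: mulr_ge0; first exact: hW.
  by move/andP: ycr => [? ?]; apply: Spos => //; lra.
move=> hh; have : C' t c * S' t c < 0 by apply: hh; lra.
have : 0 <= (- C' t c) * (- S' t c) by apply: mulr_ge0; lra.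
by rewrite mulrNN; lra.
Qed.

Lemma C'_end_lt0 t : (forall x, 0 <= x < r -> 0 < C t x) -> C t r = 0 ->
  C' t r < 0.
Proof.
move=> h Cr; have Sr := S_end_gt0 h.
have := wronskian t r; rewrite Cr mul0r sub0r => w.
by rewrite -(pmulr_llt0 _ Sr); lra.
Qed.

Lemma decreasing_odd_neumann t :
  (forall x, 0 <= x < r -> 0 < C t x) ->
  (forall x y, 0 <= x -> x <= y -> y <= r -> W y <= W x) -> W r < W 0 ->
  C t r = 0 -> S' t r < 0.
Proof.
move=> h Wmono W0r Cr.
have C'r := C'_end_lt0 h Cr.
have dH2 x : is_derive x 1 (fun y => - (C' t y * S' t y))
    ((t - W x) * (C' t x * S t x + C t x * S' t x)).
  by apply: (is_derive_eq (isderiveN (dH t x))); ring.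
have ctW : continuous (fun x => t - W x).
  by move=> x; apply: continuousB; [exact: cst_continuous|exact: cW].
have := @integration_sign_change _ _ _ _ (fun x => t - W x) r r0 dH2 (@dg t)
    (@cg' t) ctW _ _ _.
rewrite C'0 S0 Cr !mul0r !mulr0 !subr0 oppr0 oppr_lt0 => hh.
have : 0 < C' t r * S' t r.
  apply: hh.
  - by move=> x y x0 xy yb; rewrite lerD2l lerN2; exact: Wmono.
  - move=> x /andP[x0 xr]; apply: mulr_gt0; first by apply: h; rewrite ltW.
    by apply: S_pos_open => //; rewrite x0.
  - by rewrite ltrD2l ltrN2.
by rewrite nmulr_rgt0.
Qed.

(** The mixed Wronskian [C' s * C t - C s * C' t] vanishes at both ends, yet its
    derivative is [(t - s) * C s * C t > 0]. *)
Lemma even_neumann_unique s t : s < t ->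
  (forall x, 0 <= x < r -> 0 < C s x) -> (forall x, 0 <= x < r -> 0 < C t x) ->
  C' s r = 0 -> C' t r = 0 -> False.
Proof.
move=> st hs ht Cs Ct.
have d x : is_derive x 1 (fun y => C' s y * C t y - C s y * C' t y)
   ((t - s) * (C s x * C t x)).
  by apply: (is_derive_eq (isderiveB (isderiveM (dC' s x) (dC t x)) (isderiveM (dC s x) (dC' t x)))); ring.
have r2 : 0 < r / 2 by rewrite divr_gt0.
have pos q x : s < t -> (forall x, 0 <= x < r -> 0 < C q x) -> 0 <= x <= r -> 0 <= C q x.
  move=> _ hq /andP[x0]; rewrite le_eqVlt => /predU1P[->|xr]; first exact: C_end_ge0.
  by apply/ltW/hq; rewrite x0.
have ts : 0 < t - s by rewrite subr_gt0.
have h1 := deriv_gt0_lt r2 (fun y _ => d y) _.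
have h2 : r / 2 <= r by lra.
have h3 := deriv_ge0_le h2 (fun y _ => d y) _.
move: h1 h3; rewrite Cs Ct !C'0 !mul0r !mulr0 subrr => h1 h3.
suff : (0 : R) < 0 by rewrite ltxx.
apply: lt_le_trans (h3 _); first apply: h1.
- move=> x /andP[x0 xr]; apply: mulr_gt0 => //.
  by apply: mulr_gt0; [apply: hs|apply: ht]; rewrite x0; lra.
- move=> x /andP[x0 xr]; apply: mulr_ge0; first exact: ltW.
  by apply: mulr_ge0; apply: pos => //; apply/andP; split; lra.
Qed.

(** Both [C' t r] and [S' t r] are positive for very negative [t] and negative
    at [t = l]. They have no common zero, by the Wronskian identity, so the two
    parameters differ. *)
Lemma two_neumann_below l :
  (forall x, 0 <= x < r -> 0 < C l x) -> C l r = 0 -> S' l r < 0 ->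
  exists s t, [/\ s < l, t < l, s != t, C' s r = 0 & S' t r = 0].
Proof.
move=> h Cr S'r; have C'r := C'_end_lt0 h Cr.
pose t0 := Num.min (- M - 1) l.
have t0l : t0 <= l by rewrite /t0 ge_min lexx orbT.
have t0M : t0 <= - M - 1 by rewrite /t0 ge_min lexx.
have ivt (f : R -> R) : continuous f -> 0 < f t0 -> f l < 0 ->
    exists2 s, s < l & f s = 0.
  move=> cf f0 fl.
  have cN : continuous (fun x => - f x) by move=> x; apply: continuousN; exact: cf.
  have [|s /andP[_ sl] fs] := ivt_zero cN t0l.
    by rewrite oppr_le0 oppr_ge0 !ltW.
  have {}fs : f s = 0 by apply/eqP; rewrite -oppr_eq0 fs.
  exists s => //; rewrite lt_neqAle sl andbT; apply/eqP => e.
  by move: fl; rewrite -e fs ltxx.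
have [_ C'0r] := low_energy_C t0M r0.
have [s sl es] := ivt _ C'_continuous C'0r C'r.
have [t tl et] := ivt _ S'_continuous (low_energy_S' t0M r0) S'r.
exists s, t; split => //; apply/eqP => e.
have := wronskian s r; rewrite es e et mulr0 mul0r subrr => /eqP.
by rewrite eq_sym oner_eq0.
Qed.

End Comparison.

(** * Weak derivatives and primitives *)

Section SmallRemainder.
Context {R : realType}.
Implicit Types (F : R -> R) (x h d e : R).

Lemma isderive_of_remainder F x d :
  (forall e, 0 < e -> exists2 del, 0 < del &
     forall h, `|h| < del -> `|F (x + h) - F x - h * d| <= e * `|h|) ->
  is_derive x 1 F d.
Proof.
move=> rem.
have fe (a k : R) : k != 0 -> d - k^-1 * a = - k^-1 * (a - k * d).
  by move=> k0; field.
have c : h^-1 *: (F (h *: (1 : R) + x) - F x) @[h --> 0^'] --> d.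
  apply/cvgrPdist_le => /= e e0; have [del del0 hdel] := rem e e0.
  near=> h.
  have h0 : h != 0 by near: h; exact: nbhs_dnbhs_neq.
  have hd : `|h| < del.
    near: h; apply: dnbhs0_lt; exact: del0.
  have := hdel h hd.
  rewrite /GRing.scale /= mulr1 (addrC h).
  rewrite (fe _ _ h0).
  by rewrite normrM normrN normfV ler_pdivrMl ?normr_gt0// [leRHS]mulrC [`|h| * e]mulrC.
have dF : derivable F x 1 by apply/cvg_ex; exists d.
by apply: DeriveDef => //; exact: cvg_lim.
Unshelve. all: by end_near. Qed.

Lemma isderive_of_quadratic_remainder F x d (k : R) :
  (forall h, `|F (x + h) - F x - h * d| <= k * h ^+ 2) ->
  is_derive x 1 F d.
Proof.
move=> hF; apply: isderive_of_remainder => e e0.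
have k0 : 0 <= k by have := le_trans (normr_ge0 _) (hF 1); rewrite expr1n mulr1.
have k1 : 0 < k + 1 by lra.
exists (e / (k + 1)); first by rewrite divr_gt0.
move=> h; rewrite ltr_pdivlMr// => he; apply: (le_trans (hF h)).
rewrite -real_normK ?num_real// expr2 mulrA ler_wpM2r//.
by have := normr_ge0 h; nra.
Qed.

(** Translates of [ramp ^+ 2] are the building blocks of the test functions
    below: they are of class C^1 and their combinations can be made to vanish
    outside a compact set. *)
Definition ramp (x : R) : R := Num.max 0 x.

Lemma ramp_pos x : 0 <= x -> ramp x = x.
Proof. by move=> x0; rewrite /ramp; apply/max_idPr. Qed.

Lemma ramp_neg x : x <= 0 -> ramp x = 0.
Proof. by move=> x0; rewrite /ramp; apply/max_idPl. Qed.

Lemma ramp_sq_remainder x h : 0 <= ramp (x + h) ^+ 2 - ramp x ^+ 2 - h * (2 * ramp x) <= h ^+ 2.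
Proof.
have [x0|/ltW x0] := leP 0 x; have [xh|/ltW xh] := leP 0 (x + h);
  rewrite ?(ramp_pos x0) ?(ramp_neg x0) ?(ramp_pos xh) ?(ramp_neg xh); apply/andP; split; nra.
Qed.

Lemma isderive_ramp_sq x : is_derive x 1 (fun y => ramp y ^+ 2) (2 * ramp x).
Proof.
apply: (@isderive_of_quadratic_remainder _ _ _ 1) => h.
have /andP[h1 h2] := ramp_sq_remainder x h.
by rewrite mul1r ger0_norm.
Qed.

Lemma ramp_continuous : continuous ramp.
Proof.
move=> x; apply/cvgrPdist_le => /= e e0.
near=> y.
have : `|x - y| <= e by near: y; apply: cvgr_dist_le => //; exact: cvg_id.
apply: le_trans; rewrite ler_norml.
have a1 := ler_norm (x - y); have a2 := ler_norm (- (x - y)); rewrite normrN in a2.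
have [x0|/ltW x0] := leP 0 x; have [xh|/ltW xh] := leP 0 y;
  rewrite ?(ramp_pos x0) ?(ramp_neg x0) ?(ramp_pos xh) ?(ramp_neg xh);
  apply/andP; split; lra.
Unshelve. all: by end_near. Qed.

(** The ramp is affine on each side of its corner, so the remainder is supported
    within distance [|h|] of it; this locality is what allows one to
    differentiate [\int u x * ramp (x - p)] in [p] for a merely integrable [u]. *)
Lemma ramp_remainder x h :
  `|ramp (x + h) - ramp x - h * (0 < x)%R%:R| <= `|h| * (`|x| <= `|h|)%R%:R.
Proof.
have [xh|xh] := leP `|x| `|h|.
  rewrite mulr1 ler_norml.
  have [h0|/ltW h0] := leP 0 h.
    rewrite (ger0_norm h0) in xh *; move: xh; rewrite ler_norml => /andP[h1 h2].
    rewrite (@ramp_pos (x + h)); last lra.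
    have [x0|x0] := ltP 0 x; first by rewrite (ramp_pos (ltW x0)) /=; apply/andP; split; lra.
    by rewrite (ramp_neg x0) /=; apply/andP; split; lra.
  rewrite (ler0_norm h0) in xh *; move: xh; rewrite ler_norml => /andP[h1 h2].
  rewrite (@ramp_neg (x + h)); last lra.
  have [x0|x0] := ltP 0 x; first by rewrite (ramp_pos (ltW x0)) /=; apply/andP; split; lra.
  by rewrite (ramp_neg x0) /=; apply/andP; split; lra.
rewrite mulr0 normr_le0 subr_eq0.
have : - `|h| <= h by have := ler_norm (- h); rewrite normrN; lra.
have := ler_norm h => h1 h2.
have [x0|x0] := ltP 0 x.
  rewrite (gtr0_norm x0) in xh; rewrite !ramp_pos//=; [|lra|lra].
  by apply/eqP; ring.
rewrite (ler0_norm x0) in xh; rewrite !ramp_neg//=; last lra.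
by apply/eqP; ring.
Qed.

End SmallRemainder.

Section WeakDerivative.
Context {R : realType}.
Notation mu := (@lebesgue_measure R).
Implicit Types (u w k f : R -> R) (x y p q h e c : R).
Variables (a b : R).
Notation I := (`]a, b[%classic).
Notation integrable_I u := (mu.-integrable I (EFin \o u)).

Let mI : @measurable _ (measurableTypeR R) I.
Proof. exact: measurable_itv. Qed.

Let ext u : R -> R := u \_ I.

Lemma ext_integrable u : integrable_I u -> mu.-integrable setT (EFin \o ext u).
Proof.
by rewrite integrable_mkcond//= restrict_EFin.
Qed.

Lemma integrable_mul_bounded u k (B : R) : integrable_I u ->
  measurable_fun setT k -> (forall x, I x -> `|k x| <= B) ->
  integrable_I (fun x => u x * k x).
Proof.
move=> iu mk kB.
have := @integrableMl _ _ _ mu I mI (EFin \o u) k iu.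
move=> /(_ (measurable_funS measurableT (@subsetT _ _) mk)); apply.
exists B; split; first exact: num_real.
by move=> N BN x Ix /=; apply: (le_trans (kB _ Ix)); exact: ltW.
Qed.

Lemma weighted_integral_le u k (A : set R) c : integrable_I u ->
  measurable_fun setT k -> @measurable _ (measurableTypeR R) A -> 0 <= c ->
  (forall x, I x -> `|k x| <= c * \1_A x) ->
  `|\int[mu]_(x in I) (u x * k x)| <= c * \int[mu]_(x in A) `|ext u x|.
Proof.
move=> iu mk mA c0 kA.
have kc x : I x -> `|k x| <= c.
  by move=> Ix; apply: (le_trans (kA x Ix)); rewrite -[leRHS]mulr1 ler_wpM2l//.
have iuk := integrable_mul_bounded iu mk kc.
apply: (le_trans (le_normr_Rintegral mI iuk)).
have iext := ext_integrable iu.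
have iabs : mu.-integrable setT (EFin \o (fun x => `|ext u x|)).
  by have := integrable_norm iext.
have iA : mu.-integrable A (EFin \o (fun x => `|ext u x|)).
  by apply: integrableS iabs.
rewrite -RintegralZl// Rintegral_mkcond [leRHS]Rintegral_mkcond.
apply: le_Rintegral => //.
- have i1 : integrable_I (fun x => `|u x * k x|) by have := integrable_norm iuk.
  by have := ext_integrable i1.
- have i2 : mu.-integrable A (EFin \o (fun x => c * `|ext u x|)).
    by have := integrableZl mA c iA; apply.
  by move: i2; rewrite (integrable_mkcond _ mA) restrict_EFin.
move=> x _; rewrite [leLHS]patchE [leRHS]patchE.
case: ifPn => [xI|_]; last by case: ifPn => // _; rewrite mulr_ge0.
have := kA x; rewrite inE in xI => /(_ xI); rewrite indicE.
have e : ext u x = u x by rewrite /ext patchE mem_set.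
case: (x \in A) => /= h; rewrite ?e normrM mulrC.
  by rewrite mulr1 in h; apply: ler_wpM2r.
rewrite mulr0 in h; have -> : `|k x| = 0 by apply/eqP; rewrite eq_le h normr_ge0.
by rewrite mul0r.
Qed.

(* Taken from the right end, K is a second primitive of u and L is twice a third
   one; F is a first primitive taken from the left and T the total integral. *)
Let K u p := \int[mu]_(x in I) (u x * ramp (x - p)).
Let L u p := \int[mu]_(x in I) (u x * ramp (x - p) ^+ 2).
Let F u p := \int[mu]_(x in `]-oo, p]) ext u x.
Let T u := \int[mu]_(x in I) u x.

Lemma tail_integral u p : integrable_I u ->
  \int[mu]_(x in I) (u x * (p < x)%R%:R) = T u - F u p.
Proof.
move=> iu; have iext := ext_integrable iu.
rewrite /T [X in X - _]Rintegral_mkcond -/(ext u).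
have := @Rintegral_itvB R (ext u) -oo%O +oo%O p _ _ _.
rewrite set_itvNyy => ->//.
rewrite Rintegral_mkcond [RHS]Rintegral_mkcond.
apply: eq_Rintegral => x _; rewrite /ext !patchE.
rewrite (_ : (x \in `]p, +oo[%classic) = (p < x)); last first.
  by apply/idP/idP => [|px]; rewrite ?inE /= in_itv /= andbT.
by case: ifPn => _; case: (p < x); rewrite ?mulr1 ?mulr0.
Qed.

Let absI x : I x -> `|x| <= `|a| + `|b|.
Proof.
rewrite /= in_itv /= => /andP[ax xb]; rewrite ler_norml.
have := ler_norm (- a); have := ler_norm b; rewrite normrN.
have := normr_ge0 a; have := normr_ge0 b.
by move=> *; apply/andP; split; lra.
Qed.

Let ramp_le x y p : `|x| <= y -> `|ramp (x - p)| <= y + `|p|.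
Proof.
move=> xy; apply: (@le_trans _ _ `|x - p|).
  have [h|/ltW h] := leP 0 (x - p); first by rewrite ramp_pos.
  by rewrite ramp_neg// normr0.
by apply: (le_trans (ler_normB _ _)); rewrite lerD2r.
Qed.

Let mramp p : measurable_fun setT (fun x => ramp (x - p)).
Proof.
apply: continuous_measurable_fun => x.
apply: (@continuous_comp _ _ _ (fun x => x - p) (@ramp R) x).
  by apply: continuousB; [exact: cvg_id|exact: cst_continuous].
exact: ramp_continuous.
Qed.

Lemma K_integrable u p : integrable_I u -> integrable_I (fun x => u x * ramp (x - p)).
Proof.
move=> iu; apply: (integrable_mul_bounded (B := `|a| + `|b| + `|p|)) => //.
by move=> x /absI; exact: ramp_le.
Qed.

Lemma L_integrable u p : integrable_I u ->
  integrable_I (fun x => u x * ramp (x - p) ^+ 2).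
Proof.
move=> iu; apply: (integrable_mul_bounded (B := (`|a| + `|b| + `|p|) ^+ 2)) => //.
  exact: measurable_funX.
by move=> x /absI/(ramp_le p) h; rewrite normrX ler_pXn2r// nnegrE//.
Qed.

(** The quadratic bound on the remainder of [ramp ^+ 2] may be integrated. *)
Lemma L_derive u p : integrable_I u -> is_derive p 1 (L u) (- 2 * K u p).
Proof.
move=> iu; apply: (@isderive_of_quadratic_remainder _ _ _ _ (\int[mu]_(x in setT) `|ext u x|)) => h.
pose k x := ramp (x - (p + h)) ^+ 2 - ramp (x - p) ^+ 2 + 2 * h * ramp (x - p).
have mk : measurable_fun setT k.
  apply: measurable_funD; last exact: measurable_funM.
  by apply: measurable_funB; apply: measurable_funX.
have hk x : I x -> `|k x| <= h ^+ 2 * \1_setT x.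
  move=> _; rewrite indicT mulr1.
  have := ramp_sq_remainder (x - p) (- h).
  rewrite sqrrN (_ : x - p - h = x - (p + h)); last by ring.
  rewrite /k => /andP[h1 h2]; rewrite ger0_norm; lra.
have := weighted_integral_le iu mk measurableT (sqr_ge0 h) hk.
rewrite mulrC; congr (`|_| <= _).
have e x : u x * k x = u x * ramp (x - (p + h)) ^+ 2 - u x * ramp (x - p) ^+ 2
    + 2 * h * (u x * ramp (x - p)) by rewrite /k; ring.
under eq_Rintegral do rewrite e.
have i1 := L_integrable (p + h) iu; have i2 := L_integrable p iu.
have i3 := K_integrable p iu.
rewrite RintegralD//.
- by rewrite RintegralB// RintegralZl// /L /K; ring.
- by have := integrableB mI i1 i2; apply.
- by have := integrableZl mI (2 * h) i3; apply.
Qed.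

(** The remainder is at most [|h|] times the integral of [|u|] over an interval of
    length [2 |h|], which is small by absolute continuity of the integral. *)
Lemma K_derive u p : integrable_I u -> is_derive p 1 (K u) (F u p - T u).
Proof.
move=> iu; apply: isderive_of_remainder => e e0.
have [d [d0 hd]] := integral_normr_continuous (ext_integrable iu) e0.
exists (d / 3); first by rewrite divr_gt0.
move=> h hh.
pose k x := ramp (x - (p + h)) - ramp (x - p) + h * (p < x)%R%:R.
have mp : measurable_fun setT (fun x => (p < x)%R%:R : R).
  rewrite (_ : (fun x => _) = \1_`]p, +oo[); first exact: measurable_indic.
  apply/funext => x; rewrite indicE; congr (_ %:R); congr nat_of_bool.
  by apply/idP/idP => [px|]; rewrite ?inE /= in_itv /= andbT.
have mk : measurable_fun setT k.
  apply: measurable_funD; last exact: measurable_funM.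
  exact: measurable_funB.
pose A := (`[p - `|h|, p + `|h|])%classic.
have hk x : I x -> `|k x| <= `|h| * \1_A x.
  move=> _; have := ramp_remainder (x - p) (- h).
  rewrite normrN (_ : x - p - h = x - (p + h)); last by ring.
  rewrite mulNr opprK subr_gt0 -/(k x); congr (_ <= _ * _).
  rewrite indicE; congr (_ %:R); congr nat_of_bool.
  apply/idP/idP; rewrite inE /A /= in_itv /= ler_norml => /andP[? ?].
    by apply/andP; split; lra.
  by apply/andP; split; lra.
have := weighted_integral_le iu mk (measurable_itv _ : measurable A) (normr_ge0 h) hk.
have muA : (mu A < d%:E)%E.
  rewrite lebesgue_measure_itv /=; case: ifP => _; last by rewrite lte_fin.
  by rewrite -EFinB lte_fin; lra.
have sm := hd A (measurable_itv _) muA.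
move=> hle; apply: (@le_trans _ _ (`|h| * \int[mu]_(x in A) `|ext u x|)); last first.
  by rewrite mulrC ler_wpM2r// ltW.
move: hle; congr (`|_| <= _).
have ek x : u x * k x = u x * ramp (x - (p + h)) - u x * ramp (x - p)
    + h * (u x * (p < x)%R%:R) by rewrite /k; ring.
under eq_Rintegral do rewrite ek.
have i1 := K_integrable (p + h) iu; have i2 := K_integrable p iu.
have i3 : integrable_I (fun x => u x * (p < x)%R%:R).
  apply: (integrable_mul_bounded (B := 1)) => // x _.
  by case: (p < x); rewrite ?normr1 ?normr0.
rewrite RintegralD//.
- by rewrite RintegralB// RintegralZl// tail_integral// /K; ring.
- by have := integrableB mI i1 i2; apply.
- by have := integrableZl mI h i3; apply.
Qed.

Lemma integral_combination (f0 f1 f2 f3 : R -> R) (c1 c2 c3 : R) :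
  integrable_I f0 -> integrable_I f1 -> integrable_I f2 -> integrable_I f3 ->
  \int[mu]_(x in I) (f0 x - (c1 * f1 x + c2 * f2 x + c3 * f3 x)) =
  \int[mu]_(x in I) f0 x - (c1 * \int[mu]_(x in I) f1 x +
    c2 * \int[mu]_(x in I) f2 x + c3 * \int[mu]_(x in I) f3 x).
Proof.
move=> i0 i1 i2 i3.
have j1 : integrable_I (fun x => c1 * f1 x) by have := integrableZl mI c1 i1; apply.
have j2 : integrable_I (fun x => c2 * f2 x) by have := integrableZl mI c2 i2; apply.
have j3 : integrable_I (fun x => c3 * f3 x) by have := integrableZl mI c3 i3; apply.
have j12 : integrable_I (fun x => c1 * f1 x + c2 * f2 x).
  by have := integrableD mI j1 j2; apply.
have j : integrable_I (fun x => c1 * f1 x + c2 * f2 x + c3 * f3 x).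
  by have := integrableD mI j12 j3; apply.
by rewrite RintegralB// RintegralD// RintegralD// !RintegralZl.
Qed.

Hypothesis ab : a < b.

(* Three knots in (a, b), and the Lagrange polynomials for these knots. They
   reproduce polynomials of degree at most 2, hence the spline below vanishes to
   the right of all its knots; to the left of them it is trivially zero. *)
Let d := (b - a) / 4.
Let p1 := a + d.
Let p2 := a + d * 2.
Let p3 := a + d * 3.
Let l1 p := (p - p2) * (p - p3) / (2 * d ^+ 2).
Let l2 p := - ((p - p1) * (p - p3) / d ^+ 2).
Let l3 p := (p - p1) * (p - p2) / (2 * d ^+ 2).

Let d0 : 0 < d. Proof. by rewrite divr_gt0// subr_gt0. Qed.
Let b4 : b = a + d * 4. Proof. by rewrite /d; field. Qed.

Let spline p x : R := ramp (x - p) ^+ 2 - (l1 p * ramp (x - p1) ^+ 2 +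
  l2 p * ramp (x - p2) ^+ 2 + l3 p * ramp (x - p3) ^+ 2).
Let spline' p x : R := 2 * ramp (x - p) - (l1 p * (2 * ramp (x - p1)) +
  l2 p * (2 * ramp (x - p2)) + l3 p * (2 * ramp (x - p3))).

Let spline_derive p x : is_derive x 1 (spline p) (spline' p x).
Proof.
have s q : is_derive x 1 (fun x => ramp (x - q) ^+ 2) (2 * ramp (x - q)).
  have h : is_derive x 1 (fun x => x - q) 1.
    by apply: (is_derive_eq (isderiveB (is_derive_id x 1) (is_derive_cst q x 1))); rewrite subr0.
  apply: (is_derive_eq (@isderive_comp _ (fun y => ramp y ^+ 2) (fun x => x - q) x _ _
    (isderive_ramp_sq (x - q)) h)).
  by rewrite mulr1.
exact: isderiveB (s p) (isderiveD (isderiveD (isderiveZ _ (s p1)) (isderiveZ _ (s p2))) (isderiveZ _ (s p3))).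
Qed.

Let cramp q : continuous (fun x => ramp (x - q)).
Proof.
move=> x; apply: (@continuous_comp _ _ _ (fun x => x - q) (@ramp R) x).
  by apply: continuousB; [exact: cvg_id|exact: cst_continuous].
exact: ramp_continuous.
Qed.

Let spline_continuous p : continuous (spline' p).
Proof.
have c q (m : R) : continuous (fun x => m * (2 * ramp (x - q))).
  move=> x; apply: (@continuousM _ _ (cst m) (fun x => 2 * ramp (x - q)) x).
    exact: cst_continuous.
  apply: (@continuousM _ _ (cst 2) (fun x => ramp (x - q)) x).
    exact: cst_continuous.
  exact: cramp.
move=> x; apply: (@continuousB _ _ _ (fun x => 2 * ramp (x - p))
  (fun x => l1 p * (2 * ramp (x - p1)) + l2 p * (2 * ramp (x - p2)) +
            l3 p * (2 * ramp (x - p3))) x).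
  apply: (@continuousM _ _ (cst 2) (fun x => ramp (x - p)) x).
    exact: cst_continuous.
  exact: cramp.
apply: (@continuousD _ _ _ (fun x => l1 p * (2 * ramp (x - p1)) +
  l2 p * (2 * ramp (x - p2))) (fun x => l3 p * (2 * ramp (x - p3))) x).
  by apply: (@continuousD _ _ _ (fun x => l1 p * (2 * ramp (x - p1)))
    (fun x => l2 p * (2 * ramp (x - p2))) x); exact: c.
exact: c.
Qed.

Let spline_test p : a < p < b -> test_function a b (spline p).
Proof.
move=> /andP[ap pb]; split.
- by move=> x; case: (spline_derive p x).
- have -> : (spline p)^`()%classic = spline' p.
    apply/funext => x; rewrite derive1E.
    by have := @derive_val _ _ _ _ _ _ _ (spline_derive p x).
  exact: spline_continuous.
exists (`[Num.min p p1, Num.max p p3])%classic; split.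
- exact: segment_compact.
- move=> x; rewrite /= !in_itv /= ge_min le_max.
  have h1 := d0; have h2 := b4.
  move=> /andP[/orP h3 /orP h4]; apply/andP; split.
    by case: h3; rewrite /p1; lra.
  by case: h4; rewrite /p3; lra.
move=> x; rewrite /= in_itv /= => /negP; rewrite negb_and -!ltNge.
have h1 := d0.
case/orP => [|].
  rewrite lt_min => /andP[xp xp1]; rewrite /p1 in xp1.
  by rewrite /spline !ramp_neg ?expr0n /= ?mulr0 ?subr0 ?addr0// /p1 /p2 /p3; lra.
rewrite gt_max => /andP[px p3x]; rewrite /p3 in p3x.
rewrite /spline !ramp_pos; try (rewrite /p1 /p2 /p3; lra).
rewrite /l1 /l2 /l3 /p1 /p2 /p3; field.
by rewrite gt_eqF.
Qed.

(** Testing with the spline of a fourth knot [p] says that [2 K u + L w] agrees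
    at [p] with its Lagrange interpolation at the three fixed knots. *)
Lemma weak_derivative_quadratic u w : integrable_I u -> integrable_I w ->
  weak_derivative a b u w ->
  exists A B G : R, forall p, a < p < b ->
    2 * K u p + L w p = A + B * p + G * p ^+ 2.
Proof.
move=> iu iw uw.
pose Phi p := 2 * K u p + L w p.
have key p : a < p < b -> Phi p = l1 p * Phi p1 + l2 p * Phi p2 + l3 p * Phi p3.
  move=> pab; have := uw _ (spline_test pab).
  have -> : (spline p)^`()%classic = spline' p.
    apply/funext => x; rewrite derive1E.
    by have := @derive_val _ _ _ _ _ _ _ (spline_derive p x).
  have e1 x : u x * spline' p x = 2 * (u x * ramp (x - p)) -
     (2 * l1 p * (u x * ramp (x - p1)) + 2 * l2 p * (u x * ramp (x - p2)) +
      2 * l3 p * (u x * ramp (x - p3))) by rewrite /spline'; ring.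
  have e2 x : w x * spline p x = w x * ramp (x - p) ^+ 2 -
     (l1 p * (w x * ramp (x - p1) ^+ 2) + l2 p * (w x * ramp (x - p2) ^+ 2) +
      l3 p * (w x * ramp (x - p3) ^+ 2)) by rewrite /spline; ring.
  under eq_Rintegral do rewrite e1.
  under [in X in _ = X]eq_Rintegral do rewrite e2.
  have iK q := K_integrable q iu; have iL q := L_integrable q iw.
  have i2 : integrable_I (fun x => 2 * (u x * ramp (x - p))).
    by have := integrableZl mI 2 (iK p); apply.
  rewrite !integral_combination// RintegralZl// /Phi /K /L.
  lra.
pose w1 := Phi p1 / (2 * d ^+ 2); pose w2 := - (Phi p2 / d ^+ 2).
pose w3 := Phi p3 / (2 * d ^+ 2).
exists (w1 * p2 * p3 + w2 * p1 * p3 + w3 * p1 * p2),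
  (- (w1 * (p2 + p3) + w2 * (p1 + p3) + w3 * (p1 + p2))), (w1 + w2 + w3) => p pab.
rewrite -/(Phi p) key// /l1 /l2 /l3 /w1 /w2 /w3; field.
by rewrite gt_eqF.
Qed.

(** The quadratic polynomial [2 K u + L w] may be differentiated twice. The first
    derivative expresses the primitive of [u] through [K w]; the right-hand side
    is differentiable at every point, with derivative the primitive of [w] up to
    a constant, and the left-hand side has derivative [u] almost everywhere. *)
Theorem weak_derivative_primitive u w : integrable_I u -> integrable_I w ->
  weak_derivative a b u w ->
  exists c, same_ae a b u (fun x => c + \int[mu]_(t in `]-oo, x]) (w \_ I) t).
Proof.
move=> iu iw uw.
have [A [B [G h]]] := weak_derivative_quadratic iu iw uw.
have near_ab p : a < p < b -> \forall q \near p, a < q < b.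
  move=> pab; have /near_in_itvoo : p \in `]a, b[ by rewrite in_itv.
  by apply: filterS => q; rewrite in_itv.
have hF p : a < p < b -> F u p = T u + K w p + B / 2 + G * p.
  move=> pab.
  have D1 : is_derive p 1 (fun q => 2 * K u q + L w q)
      (2 * (F u p - T u) + - 2 * K w p).
    exact: isderiveD (isderiveZ 2 (K_derive p iu)) (L_derive p iw).
  have D2 : is_derive p 1 (fun q => A + B * q + G * q ^+ 2) (B + 2 * G * p).
    rewrite (_ : (fun q => _) = (fun q => A + B * q + G * (q * q))); last first.
      by apply/funext => q; rewrite expr2.
    have i := is_derive_id p 1.
    apply: (is_derive_eq (isderiveD (isderiveD (is_derive_cst A p 1) (isderiveZ B i)) (isderiveZ G (isderiveM i i)))).
    by ring.
  have D3 : is_derive p 1 (fun q => A + B * q + G * q ^+ 2)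
      (2 * (F u p - T u) + - 2 * K w p).
    apply: near_eq_is_derive D1; near=> q; apply: h.
    by near: q; exact: near_ab.
  have e2 := @derive_val _ _ _ _ _ _ _ D2.
  have := @derive_val _ _ _ _ _ _ _ D3; rewrite e2; lra.
exists (G - T w).
have iext := ext_integrable iu.
have iray y : mu.-integrable `]-oo, y] (EFin \o ext u).
  by apply: integrableS iext => //; exact: measurable_itv.
have := FTC1Ny iray (integrable_locally mI iu).
apply: filterS; first exact: (ae_filter_ringOfSetsType mu).
move=> x [dF eF] xab.
have {xab} xab : a < x < b by rewrite in_itv in xab.
have D1 : is_derive x 1 (F u) (F w x - T w + G).
  have i := is_derive_id x 1.
  apply: (@near_eq_is_derive _ _ _ (fun p => T u + K w p + B / 2 + G * p)).
    near=> q; apply/esym; apply: hF.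
    by near: q; exact: near_ab.
  apply: (is_derive_eq (isderiveD (isderiveD (isderiveD (is_derive_cst (T u) x 1) (K_derive x iw))
     (is_derive_cst (B / 2) x 1)) (isderiveZ G i))).
  by ring.
have e1 := @derive_val _ _ _ _ _ _ _ D1.
have : ext u x = u x.
  by rewrite /ext patchE mem_set//= in_itv.
move=> <-; rewrite -eF derive1E e1 /F /ext; ring.
Unshelve. all: by end_near. Qed.

End WeakDerivative.

(** * Weak and classical solutions *)

Section Transfer.
Context {R : realType}.
Notation mu := (@lebesgue_measure R).
Implicit Types (u w f g : R -> R) (x y p h e c : R).
Variables (a b : R).
Hypothesis ab : a < b.
Notation I := (`]a, b[%classic).
Notation integrable_I u := (mu.-integrable I (EFin \o u)).
Notation primitive w x := (\int[mu]_(t in `]-oo, x]) (w \_ I) t).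

Let mI : @measurable _ (measurableTypeR R) I.
Proof. exact: measurable_itv. Qed.

Let muI : (mu I < +oo)%E.
Proof. by rewrite lebesgue_measure_itv /= lte_fin ab -EFinB ltry. Qed.

(** On a bounded interval [|u| <= 1 + u ^+ 2] is integrable. *)
Lemma in_L2_integrable u : in_L2 a b u -> integrable_I u.
Proof.
move=> uL2; rewrite integrable_mkcond// restrict_EFin.
set f := u \_ I.
have mf : measurable_fun setT f.
  by move: uL2; rewrite /in_L2 inE => /andP[]; rewrite inE.
have i2 : mu.-integrable I (EFin \o (fun x => f x ^+ 2)).
  by apply: integrableS (Lfun2_integrable_sqr uL2).
have i1 : mu.-integrable I (EFin \o cst (1 : R)).
  apply: measurable_bounded_integrable => //.
  by exists 1; split; [exact: num_real|move=> N N1 x _ /=; rewrite normr1 ltW].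
have i3 : mu.-integrable I (EFin \o (fun x => 1 + f x ^+ 2)).
  by have := integrableD mI i1 i2; apply.
have i4 : integrable_I f.
  apply: le_integrable i3 => //; first exact/measurable_EFinP/measurable_funTS.
  move=> x _ /=; rewrite lee_fin [leRHS]ger0_norm ?addr_ge0 ?sqr_ge0//.
  rewrite -(real_normK (num_real (f x))).
  by have := sqr_ge0 (`|f x| - 1); rewrite sqrrB1; have := normr_ge0 (f x); nra.
have := ext_integrable i4.
by rewrite /f -patch_setI setIid.
Qed.

Lemma continuous_in_L2 w : continuous w -> in_L2 a b w.
Proof.
move=> cw; rewrite /in_L2 inE; apply/andP.
have mw : measurable_fun setT (w \_ I).
  apply/(measurable_restrictT _ _).1 => //.
  by apply: measurable_funTS; exact: continuous_measurable_fun.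
split; first by rewrite inE.
rewrite inE /= /finite_norm unlock /Lnorm; apply: poweR_lty.
have i : mu.-integrable `[a, b] (EFin \o (fun x => w x ^+ 2)).
  apply: continuous_compact_integrable; first exact: segment_compact.
  apply: continuous_subspaceT => x.
  by apply: (@continuous_comp _ _ _ w (fun y => y ^+ 2) x); [exact: cw|exact: exprn_continuous].
have i2 : mu.-integrable I (EFin \o (fun x => w x ^+ 2)).
  by apply: integrableS i => //; apply: subset_itv_oo_cc.
have /integrableP[_] := ext_integrable i2; apply: le_lt_trans.
apply: ge0_le_integral => //.
- by move=> x _; exact: poweR_ge0.
- apply: (@measurableT_comp _ _ _ _ _ _ (fun y : \bar R => (y `^ 2)%E)) => //.
    exact: measurable_poweR.
  apply/measurable_EFinP; exact: measurableT_comp.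
- by apply: measurableT_comp => //; have /integrableP[] := ext_integrable i2.
move=> x _ /=; rewrite !patchE; case: ifP => _; rewrite lee_fin.
  by rewrite powR_mulrn// normrX.
by rewrite normr0 powR0// pnatr_eq0.
Qed.

(** A point where they differ is a limit of a whole interval of such points, and
    an interval is not negligible. *)
Lemma same_ae_continuous_eq f g : {within `[a, b], continuous f} ->
  {within `[a, b], continuous g} -> same_ae a b f g ->
  forall x, a <= x <= b -> f x = g x.
Proof.
move=> cf cg fg x xab; apply/eqP; apply/negPn/negP => fgx.
have fg0 : 0 < `|f x - g x| by rewrite normr_gt0 subr_eq0.
have e3 : 0 < `|f x - g x| / 3 by rewrite divr_gt0.
have Dx : `[a, b]%classic x by rewrite /= in_itv.
move/subspace_continuousP : cf => /(_ x Dx)/cvgrPdist_lt /(_ _ e3) nf.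
move/subspace_continuousP : cg => /(_ x Dx)/cvgrPdist_lt /(_ _ e3) ng.
have [e e0 he] : exists2 e, 0 < e & forall y, `|x - y| < e -> a <= y <= b -> f y != g y.
  have : \forall y \near within `[a, b]%classic (nbhs x), f y != g y.
    near=> y.
    have h1 : `|f x - f y| < `|f x - g x| / 3 by near: y.
    have h2 : `|g x - g y| < `|f x - g x| / 3 by near: y.
    apply/eqP => e; rewrite e in h1.
    have := ler_normD (f x - g y) (- (g x - g y)).
    rewrite (_ : f x - g y + - (g x - g y) = f x - g x); last by ring.
    by rewrite normrN; lra.
  move=> [e /= e0 he]; exists e => //.
pose l := Num.max a (x - e); pose m := Num.min b (x + e).
have lm : l < m.
  rewrite /l /m gt_max !lt_min ab /=; move/andP: xab => [? ?].
  by apply/andP; split; [lra|apply/andP; split; lra].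
have [N [mN N0 hN]] := fg.
have sub : `]l, m[%classic `<=` N.
  move=> y; rewrite /= in_itv /= /l /m gt_max lt_min => /andP[/andP[ay xey] /andP[yb yxe]].
  apply: hN => /= h.
  have xy : `|x - y| < e by rewrite ltr_norml; apply/andP; split; lra.
  have yab : a <= y <= b by apply/andP; split; exact: ltW.
  have := he y xy yab.
  by rewrite h ?eqxx// in_itv /= ay.
have : (mu `]l, m[%classic <= mu N)%E.
  by apply: le_measure => //; rewrite inE.
rewrite [leRHS]N0 lebesgue_measure_itv /= lte_fin lm -EFinB lee_fin leNgt.
by rewrite subr_gt0 lm.
Unshelve. all: by end_near. Qed.

Lemma continuous_integrable w : continuous w -> integrable_I w.
Proof. by move=> /continuous_in_L2/in_L2_integrable. Qed.

Lemma primitive_continuous w : integrable_I w -> continuous (fun x => primitive w x).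
Proof.
move=> iw x; have iext := ext_integrable iw.
apply/cvgrPdist_le => /= e e0.
have [d [d0 hd]] := integral_normr_continuous iext e0.
have key y z : y <= z -> z - y < d -> `|primitive w z - primitive w y| <= e.
  move=> yz zyd.
  have iz : mu.-integrable `]-oo, z] (EFin \o (w \_ I)).
    by apply: integrableS iext => //; exact: measurable_itv.
  rewrite (Rintegral_itvB iz)//.
  have iyz : mu.-integrable `]y, z] (EFin \o (w \_ I)).
    by apply: integrableS iext => //; exact: measurable_itv.
  have myz : @measurable _ (measurableTypeR R) `]y, z]%classic.
    exact: measurable_itv.
  apply: (le_trans (le_normr_Rintegral myz iyz)).
  have sm : (mu `]y, z]%classic < d%:E)%E.
    rewrite lebesgue_measure_itv /=; case: ifP => _; last by rewrite lte_fin.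
    by rewrite -EFinB lte_fin.
  exact/ltW/hd.
near=> y.
have : `|x - y| < d by near: y; apply: cvgr_dist_lt => //; exact: cvg_id.
have [xy|/ltW yx] := leP x y.
  by rewrite distrC ger0_norm ?subr_ge0// distrC => h; exact: key.
by rewrite ger0_norm ?subr_ge0// => h; exact: key.
Unshelve. all: by end_near. Qed.

Lemma primitive_same_ae w f x : integrable_I w -> integrable_I f ->
  same_ae a b w f -> primitive w x = primitive f x.
Proof.
move=> iw if_ wf; rewrite /Rintegral; congr fine.
have m g : integrable_I g -> measurable_fun `]-oo, x] (EFin \o (g \_ I)).
  by move=> /ext_integrable/integrableP[mg _]; apply: measurable_funS mg.
apply: ae_eq_integral => //; [exact: m|exact: m|].
move: wf; apply: filterS; first exact: (ae_filter_ringOfSetsType mu).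
move=> y h _ /=; rewrite !patchE; case: ifPn => // yI; congr EFin; apply: h.
by rewrite inE in yI.
Qed.

Lemma primitive_derive w x : continuous w -> a < x < b ->
  is_derive x 1 (fun y => primitive w y) (w x).
Proof.
move=> cw xab; have iext := ext_integrable (continuous_integrable cw).
have ix : mu.-integrable `]-oo, x + 1] (EFin \o (w \_ I)).
  by apply: integrableS iext => //; exact: measurable_itv.
have cx : {for x, continuous (w \_ I)}.
  have c : w y @[y --> x] --> (w \_ I) x.
    by rewrite patchE mem_set; [exact: cw|rewrite /= in_itv].
  apply: cvg_trans c; apply: near_eq_cvg; near=> y.
  rewrite patchE mem_set//=; near: y; apply: near_in_itvoo; by rewrite in_itv.
have [|d1 d2] := @continuous_FTC1 R (w \_ I) -oo%O x (x + 1) _ ix (ltNyr x) cx.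
  by rewrite ltrDl.
apply: DeriveDef => //; rewrite -derive1E d2 patchE mem_set//=.
Unshelve. all: by end_near. Qed.

(** Integration by parts; a test function vanishes at both ends. *)
Lemma classical_weak_derivative u w : (forall x, is_derive x 1 u (w x)) ->
  continuous w -> weak_derivative a b u w.
Proof.
move=> du cw phi [dphi cphi [K [cK KI phi0]]].
have cu := isderive_continuous du.
have dphi' x : is_derive x 1 phi (phi^`()%classic x).
  by apply: DeriveDef; [exact: dphi|rewrite derive1E].
have cphi0 := isderive_continuous dphi'.
have phiend x : ~ I x -> phi x = 0 by move=> nx; apply: phi0 => /KI.
have phia : phi a = 0 by apply: phiend => /=; rewrite in_itv /= ltxx; case.
have phib : phi b = 0 by apply: phiend => /=; rewrite in_itv /= ltxx andbF; case.
have ioo f : continuous f -> \int[mu]_(x in I) f x = \int[mu]_(x in `[a, b]) f x.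
  move=> cf; have i : mu.-integrable `[a, b] (EFin \o f).
    by apply: continuous_compact_integrable; [exact: segment_compact|exact: continuous_subspaceT].
  rewrite -Rintegral_itv_obnd_cbnd; last first.
    apply: integrableS i => //; exact: subset_itv_oc_cc.
  rewrite -Rintegral_itv_bndo_bndc//; exact: continuous_integrable.
rewrite !ioo; last 2 first.
- by move=> x; apply: (@continuousM _ _ w phi); [exact: cw|exact: cphi0].
- by move=> x; apply: (@continuousM _ _ u (phi^`()%classic)); [exact: cu|exact: cphi].
rewrite (@Rintegration_by_parts R u phi w (phi^`()%classic) a b ab).
- by rewrite phia phib !mulr0 subrr sub0r.
- exact: continuous_subspaceT.
- split; [by move=> x _; case: (du x)|
    by apply: cvg_at_right_filter; exact: cu|by apply: cvg_at_left_filter; exact: cu].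
- by move=> x _; rewrite derive1E (@derive_val _ _ _ _ _ _ _ (du x)).
- exact: continuous_subspaceT.
- split; [by move=> x _; exact: dphi|
    by apply: cvg_at_right_filter; exact: cphi0|by apply: cvg_at_left_filter; exact: cphi0].
- by [].
Qed.

End Transfer.

Section AlmostEverywhere.
Context {R : realType}.
Variables (a b : R).
Implicit Types (f g h k u w : R -> R) (x y : R).

Lemma same_ae_imply f g h k :
  (forall x, x \in `]a, b[ -> f x = g x -> h x = k x) ->
  same_ae a b f g -> same_ae a b h k.
Proof.
move=> H; apply: filterS; first exact: (ae_filter_ringOfSetsType lebesgue_measure).
by move=> x fg xI; apply: H (fg xI).
Qed.

Lemma same_ae_imply2 f g f' g' h k :
  (forall x, x \in `]a, b[ -> f x = g x -> f' x = g' x -> h x = k x) ->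
  same_ae a b f g -> same_ae a b f' g' -> same_ae a b h k.
Proof.
move=> H; apply: filterS2; first exact: (ae_filter_ringOfSetsType lebesgue_measure).
by move=> x fg fg' xI; apply: H (fg xI) (fg' xI).
Qed.

Lemma same_ae_of_eq f g : (forall x, x \in `]a, b[ -> f x = g x) -> same_ae a b f g.
Proof.
move=> h; exists set0; split; [exact: measurable0|exact: measure0|].
by move=> x /= hx; apply: hx => /h.
Qed.

Hypothesis ab : a < b.

Lemma trace_value u w x v : trace a b u x v -> same_ae a b u w -> continuous w ->
  a <= x <= b -> w x = v.
Proof.
move=> [f [cf uf <-]] uw cw xab.
apply: (same_ae_continuous_eq ab _ cf _ xab); first exact: continuous_subspaceT.
by apply: (same_ae_imply2 _ uw uf) => y _ <- <-.
Qed.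

Lemma continuous_trace w x : continuous w -> trace a b w x (w x).
Proof.
move=> cw; exists w; split=> //; first exact: continuous_subspaceT.
exact: same_ae_of_eq.
Qed.

End AlmostEverywhere.

(** * Reading a list of eigenvalues *)

Section EigenvalueList.
Context {R : realType}.
Variables (a b : R) (A : (R -> R) -> (R -> R) -> Prop) (l : nat -> R).
Hypothesis Al : eigenvalues a b A l.

(* Equipotence with [`I_n] is turned into a bijection f, which is used only
   through the images of particular indices. *)
Let multiplicity t : exists n (e : 'I_n -> R -> R) (f : nat -> nat),
  [/\ forall i, A (e i) (fun x => t * e i x),
   forall c : 'I_n -> R,
     same_ae a b (fun x => \sum_(i < n) c i * e i x) (cst 0) -> forall i, c i = 0,
   forall u, A u (fun x => t * u x) -> exists c : 'I_n -> R,
     same_ae a b u (fun x => \sum_(i < n) c i * e i x) &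
   set_bij [set k | (1 <= k)%N /\ l k = t] `I_n f].
Proof.
have [n [[e [he free span]] /card_set_bijP[f bij]]] := Al.2 t.
by exists n, e, f.
Qed.

Lemma eigenvalue_listed t u : A u (fun x => t * u x) ->
  ~ same_ae a b u (cst 0) -> exists2 k, (1 <= k)%N & l k = t.
Proof.
move=> Au u0; have [n [e [f [_ _ span [_ _ sj]]]]] := multiplicity t.
case: n e span sj => [|n] e span sj.
  have [c hc] := span u Au.
  exfalso; apply: u0; apply: same_ae_imply hc => x _ ->; by rewrite big_ord0.
have [//|k [k1 lk] _] := sj 0%N.
by exists k.
Qed.

Lemma listed_eigenvalue k : (1 <= k)%N ->
  exists2 u, A u (fun x => l k * u x) & ~ same_ae a b u (cst 0).
Proof.
move=> k1; have [n [e [f [he free _ [fn _ _]]]]] := multiplicity (l k).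
have fk : (f k < n)%N by apply: fn.
pose i0 := Ordinal fk.
exists (e i0); first exact: he.
move=> h; have := free (fun i => (i == i0)%:R) _ i0.
rewrite eqxx => h0; suff : (1 : R) = 0 by move/eqP; rewrite oner_eq0.
apply: h0; apply: same_ae_imply h => x _ e0.
rewrite (bigD1 i0)//= eqxx mul1r e0 big1 ?addr0// => i /negPf ->.
by rewrite mul0r.
Qed.

(** The bijection sends [j] and [k] to distinct indices of a basis. *)
Lemma repeated_eigenvalue j k : (1 <= j)%N -> (j < k)%N -> l j = l k ->
  exists u w, [/\ A u (fun x => l j * u x), A w (fun x => l j * w x) &
    forall c d, same_ae a b (fun x => c * u x + d * w x) (cst 0) -> c = 0 /\ d = 0].
Proof.
move=> j1 jk ljk; have [n [e [f [he free _ [fn inj _]]]]] := multiplicity (l j).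
have fj : (f j < n)%N by apply: fn.
have fk : (f k < n)%N by apply: fn; split=> //; exact: leq_trans jk.
pose i0 := Ordinal fj; pose i1 := Ordinal fk.
have i10 : i1 != i0.
  apply/eqP => /(congr1 val) /= E.
  have : k = j.
    by apply: inj => //; rewrite inE; split=> //; exact: leq_trans jk.
  by move=> kj; move: jk; rewrite kj ltnn.
exists (e i0), (e i1); split; [exact: he|exact: he|].
move=> c d h; pose g i := if i == i0 then c else if i == i1 then d else 0.
have hg : forall i, g i = 0.
  apply: free; apply: same_ae_imply h => x _ E.
  rewrite (bigD1 i0)//= (bigD1 i1)//= /g eqxx (negPf i10) eqxx.
  rewrite big1 ?addr0 ?E// => i /andP[/negPf -> /negPf ->].
  by rewrite mul0r.
have := hg i0; have := hg i1; rewrite /g eqxx (negPf i10) eqxx.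
by move=> -> ->.
Qed.

End EigenvalueList.

(** * Eigenfunctions and the two comparisons *)

Section Eigenfunctions.
Context {R : realType}.
Implicit Types (x y z s t : R).
Notation mu := (@lebesgue_measure R).
Variables (r M : R) (V W : R -> R) (C C' S S' : R -> R -> R).
Hypotheses (r0 : 0 < r) (cW : continuous W) (WM : forall x, `|W x| <= M)
  (Weven : forall x, W (- x) = W x)
  (VW : forall x, x \in `](- r), r[ -> V x = W x).
Hypotheses (famC : solution_family W C C' 1 0) (famS : solution_family W S S' 0 1).

Let rr : - r < r. Proof. by apply: lt_trans r0; rewrite oppr_lt0. Qed.

Let dC t x : is_derive x 1 (C t) (C' t x).
Proof. by have [s _ _] := famC t; have [] := s x I. Qed.
Let dC' t x : is_derive x 1 (C' t) ((W x - t) * C t x).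
Proof. by have [s _ _] := famC t; have [] := s x I. Qed.
Let dS t x : is_derive x 1 (S t) (S' t x).
Proof. by have [s _ _] := famS t; have [] := s x I. Qed.
Let dS' t x : is_derive x 1 (S' t) ((W x - t) * S t x).
Proof. by have [s _ _] := famS t; have [] := s x I. Qed.

Let cmul t (u : R -> R) : continuous u -> continuous (fun x => (W x - t) * u x).
Proof.
move=> cu x; apply: (@continuousM _ _ (fun x => W x - t) u x); last exact: cu.
by apply: continuousB; [exact: cW|exact: cst_continuous].
Qed.

(** Bootstrap: [u1] is a primitive of [u2] and [u] one of [u1], so both have
    continuous representatives [U1] and [U]; then [u2 = (W - t) U] has one as
    well, and the two primitives become classical ones. *)
Lemma weak_solution_classical t u u1 u2 : in_H2 (- r) r u u1 u2 ->
  same_ae (- r) r (fun x => t * u x) (fun x => - u2 x + V x * u x) ->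
  exists al be,
    same_ae (- r) r u (fun x => al * C t x + be * S t x) /\
    same_ae (- r) r u1 (fun x => al * C' t x + be * S' t x).
Proof.
move=> [uL2 u1L2 u2L2 uu1 u1u2] eq.
have iu := in_L2_integrable rr uL2; have iu1 := in_L2_integrable rr u1L2.
have iu2 := in_L2_integrable rr u2L2.
have [c0 hc0] := weak_derivative_primitive rr iu iu1 uu1.
have [c1 hc1] := weak_derivative_primitive rr iu1 iu2 u1u2.
pose prim (w : R -> R) x := \int[mu]_(t in `]-oo, x]) (w \_ `](- r), r[) t.
pose U1 x := c1 + prim u2 x; pose U x := c0 + prim u1 x.
have cadd (c : R) (w : R -> R) : continuous w -> continuous (fun x => c + w x).
  move=> cw x; apply: (@continuousD _ _ _ (cst c) w x); last exact: cw.
  exact: cst_continuous.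
have cU1 : continuous U1 by apply: cadd; exact: primitive_continuous.
have cU : continuous U by apply: cadd; exact: primitive_continuous.
have U1E x : U x = c0 + prim U1 x.
  rewrite /U /prim; congr (_ + _).
  by apply: primitive_same_ae => //; exact: continuous_integrable.
pose Q x := (W x - t) * U x.
have cQ : continuous Q by exact: cmul.
have u2Q : same_ae (- r) r u2 Q.
  apply: (same_ae_imply2 _ eq hc0) => x xI e1 e2.
  have {}e2 : u x = U x := e2.
  have -> : u2 x = V x * u x - t * u x by lra.
  by rewrite /Q -e2 (VW xI); ring.
have U2E x : U1 x = c1 + prim Q x.
  rewrite /U1 /prim; congr (_ + _).
  by apply: primitive_same_ae => //; exact: continuous_integrable.
have sol : solution [set y | `|y| < r] (fun x => W x - t) U U1.
  move=> x /=; rewrite ltr_norml => xr; split.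
    have -> : U = fun x => c0 + prim U1 x by apply/funext => y; exact: U1E.
    by apply: (is_derive_eq (isderiveD (is_derive_cst c0 x 1) (primitive_derive rr cU1 xr))); rewrite add0r.
  have -> : U1 = fun x => c1 + prim Q x by apply/funext => y; exact: U2E.
  by apply: (is_derive_eq (isderiveD (is_derive_cst c1 x 1) (primitive_derive rr cQ xr))); rewrite add0r.
have basis := solution_basis WM famC famS sol.
exists (U 0), (U1 0); split.
  apply: same_ae_imply hc0 => x xI ->.
  by have [] := basis x; rewrite // ltr_norml; rewrite in_itv in xI.
apply: same_ae_imply hc1 => x xI ->.
by have [] := basis x; rewrite // ltr_norml; rewrite in_itv in xI.
Qed.

Let ends x : x = r \/ x = - r -> - r <= x <= r.
Proof. by have h := r0; case=> ->; apply/andP; split; lra. Qed.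

Let ccomb (f g : R -> R) al be : continuous f -> continuous g ->
  continuous (fun x => al * f x + be * g x).
Proof.
move=> cf cg x; apply: (@continuousD _ _ _ (fun x => al * f x) (fun x => be * g x) x).
  by apply: (@continuousM _ _ (cst al) f x); [exact: cst_continuous|exact: cf].
by apply: (@continuousM _ _ (cst be) g x); [exact: cst_continuous|exact: cg].
Qed.

(** By parity, the boundary values at [r] and [- r] are the sum and the
    difference of the contributions of [C] and [S], so each of them vanishes. *)
Lemma neumann_eigenfunction t u :
  neumann_schrodinger (- r) r V u (fun x => t * u x) ->
  exists al be, [/\ same_ae (- r) r u (fun x => al * C t x + be * S t x),
    al * C' t r = 0 & be * S' t r = 0].
Proof.
move=> [u1 [u2 [h2 ta tb eq]]].
have [al [be [h h1]]] := weak_solution_classical h2 eq.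
have cy := @ccomb _ _ al be (isderive_continuous (dC' t)) (isderive_continuous (dS' t)).
have ea := trace_value rr ta h1 cy (ends (or_intror erefl)).
have eb := trace_value rr tb h1 cy (ends (or_introl erefl)).
have [_ e1] := C_even WM Weven famC famS t r.
have [_ e2] := S_odd WM Weven famC famS t r.
by exists al, be; split => //; rewrite e1 e2 in ea; lra.
Qed.

Lemma dirichlet_eigenfunction t u :
  dirichlet_schrodinger (- r) r V u (fun x => t * u x) ->
  exists al be, [/\ same_ae (- r) r u (fun x => al * C t x + be * S t x),
    al * C t r = 0 & be * S t r = 0].
Proof.
move=> [u1 [u2 [h2 ta tb eq]]].
have [al [be [h h1]]] := weak_solution_classical h2 eq.
have cy := @ccomb _ _ al be (isderive_continuous (dC t)) (isderive_continuous (dS t)).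
have ea := trace_value rr ta h cy (ends (or_intror erefl)).
have eb := trace_value rr tb h cy (ends (or_introl erefl)).
have [e1 _] := C_even WM Weven famC famS t r.
have [e2 _] := S_odd WM Weven famC famS t r.
by exists al, be; split => //; rewrite e1 e2 in ea; lra.
Qed.

Lemma classical_in_H2 t u v : solution setT (fun x => W x - t) u v ->
  in_H2 (- r) r u v (fun x => (W x - t) * u x) /\
  same_ae (- r) r (fun x => t * u x) (fun x => - ((W x - t) * u x) + V x * u x).
Proof.
move=> s; have du x : is_derive x 1 u (v x) by have [] := s x I.
have dv x : is_derive x 1 v ((W x - t) * u x) by have [] := s x I.
have cu := isderive_continuous du; have cv := isderive_continuous dv.
have cq := @cmul t _ cu.
split; last by apply: same_ae_of_eq => x /VW ->; ring.
split; [exact: continuous_in_L2..| |]; exact: classical_weak_derivative.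
Qed.

Lemma C_neumann t : C' t r = 0 ->
  neumann_schrodinger (- r) r V (C t) (fun x => t * C t x).
Proof.
move=> e; have [s _ _] := famC t; have [h1 h2] := classical_in_H2 s.
have ct := isderive_continuous (dC' t).
exists (C' t), (fun x => (W x - t) * C t x); split => //.
  rewrite -(oppr0 R) -e; have [_ <-] := C_even WM Weven famC famS t r.
  exact: continuous_trace.
rewrite -e; exact: continuous_trace.
Qed.

Lemma S_neumann t : S' t r = 0 ->
  neumann_schrodinger (- r) r V (S t) (fun x => t * S t x).
Proof.
move=> e; have [s _ _] := famS t; have [h1 h2] := classical_in_H2 s.
have ct := isderive_continuous (dS' t).
exists (S' t), (fun x => (W x - t) * S t x); split => //.
  rewrite -e; have [_ <-] := S_odd WM Weven famC famS t r.
  exact: continuous_trace.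
rewrite -e; exact: continuous_trace.
Qed.

Lemma C_dirichlet t : C t r = 0 ->
  dirichlet_schrodinger (- r) r V (C t) (fun x => t * C t x).
Proof.
move=> e; have [s _ _] := famC t; have [h1 h2] := classical_in_H2 s.
have ct := isderive_continuous (dC t).
exists (C' t), (fun x => (W x - t) * C t x); split => //.
  rewrite -e; have [<- _] := C_even WM Weven famC famS t r.
  exact: continuous_trace.
rewrite -e; exact: continuous_trace.
Qed.

Lemma C_nonzero t : ~ same_ae (- r) r (C t) (cst 0).
Proof.
move=> h; have rp := r0; have := same_ae_continuous_eq rr (continuous_subspaceT (isderive_continuous (dC t)))
  (continuous_subspaceT (@cst_continuous _ _ 0)) h (x := 0).
have [_ -> _] := famC t => e; have := e _; rewrite /= => {}e.
have : (1 : R) = 0 by apply: e; apply/andP; split; lra.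
by move/eqP; rewrite oner_eq0.
Qed.

(** If [S] vanished on [[0, r]], so would [S'] somewhere, by the mean value
    theorem. *)
Lemma S_nonzero t : ~ same_ae (- r) r (S t) (cst 0).
Proof.
move=> h; have rp := r0.
have e x : - r <= x <= r -> S t x = 0.
  exact: (same_ae_continuous_eq rr (continuous_subspaceT (isderive_continuous (dS t)))
  (continuous_subspaceT (@cst_continuous _ _ 0)) h).
have [c /andP[c0 cr] E] := mean_value (ltW r0) (fun x _ => dS t x).
have Sc : S t c = 0 by apply: e; apply/andP; split; lra.
have S'c : S' t c = 0.
  move: E; rewrite !e; [|apply/andP; split; lra..].
  rewrite !subr0 => /esym/eqP; rewrite mulf_eq0 (gt_eqF r0) orbF.
  by move/eqP.
have := wronskian famC famS t c; rewrite Sc S'c !mulr0 subrr => /eqP.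
by rewrite eq_sym oner_eq0.
Qed.

Variables (nu la : nat -> R).
Hypotheses
  (nuN : eigenvalues (- r) r (neumann_schrodinger (- r) r V) nu)
  (laD : eigenvalues (- r) r (dirichlet_schrodinger (- r) r V) la).

Lemma C_positive_upto_dirichlet t : t <= la 1%N ->
  forall x, 0 <= x < r -> 0 < C t x.
Proof.
move=> tl; apply: (C_positive WM famC famS r0 _ tl) => s sl; apply/eqP => Cs.
have [k k1 lk] := eigenvalue_listed laD (C_dirichlet Cs) (@C_nonzero s).
by have := laD.1 1%N k isT k1; rewrite lk leNgt sl.
Qed.

(** All Neumann eigenvalues up to [la 1] have even eigenfunctions, of one sign;
    there is room for only one of them. *)
Lemma dirichlet_lt_neumann :
  (forall x y, 0 <= x -> x <= y -> y <= r -> W x <= W y) -> W 0 < W r ->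
  la 1%N < nu 2%N.
Proof.
move=> Wmono W0r; rewrite ltNge; apply/negP => ml.
have even k : (1 <= k)%N -> nu k <= la 1%N ->
    forall u, neumann_schrodinger (- r) r V u (fun x => nu k * u x) ->
    exists2 al, same_ae (- r) r u (fun x => al * C (nu k) x) &
      al * C' (nu k) r = 0.
  move=> k1 kl u /neumann_eigenfunction[al [be [h h1 h2]]]; exists al => //.
  have Sr := increasing_odd_neumann cW famC famS r0
    (C_positive_upto_dirichlet kl) Wmono W0r.
  have b0 : be = 0.
    by move/eqP: h2; rewrite mulf_eq0 (negPf Sr) orbF => /eqP.
  by apply: same_ae_imply h => x _ ->; rewrite b0 mul0r addr0.
have m12 : nu 1%N <= nu 2%N by apply: nuN.1.
have m1l := le_trans m12 ml.
have C'r k : (1 <= k)%N -> nu k <= la 1%N -> C' (nu k) r = 0.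
  move=> k1 kl; have [u uk u0] := listed_eigenvalue nuN k1.
  have [al h /eqP] := even k k1 kl u uk.
  rewrite mulf_eq0 => /orP[/eqP al0|/eqP//].
  by exfalso; apply: u0; apply: same_ae_imply h => x _ ->; rewrite al0 mul0r.
move: m12; rewrite le_eqVlt => /predU1P[m12|m12].
  (* a double eigenvalue would have two independent multiples of C *)
  have [u [w [hu hw ind]]] := repeated_eigenvalue nuN (isT : (1 <= 1)%N)
    (isT : (1 < 2)%N) m12.
  have [al hal _] := even 1%N isT m1l u hu.
  have [be hbe _] := even 1%N isT m1l w hw.
  have [|b0 a0] := ind be (- al).
    by apply: (same_ae_imply2 _ hal hbe) => x _ -> ->; rewrite /=; ring.
  have [|] := ind 1 0; last by move=> /eqP; rewrite oner_eq0.
  apply: same_ae_imply hal => x _ ->.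
  by rewrite -(opprK al) a0 oppr0 !mul0r mulr0 addr0.
exact: (even_neumann_unique famC r0 m12 (C_positive_upto_dirichlet m1l)
  (C_positive_upto_dirichlet ml) (C'r 1%N isT m1l) (C'r 2%N isT ml)).
Qed.

(** The Dirichlet ground state is even, because [S] is positive at [r]. *)
Lemma neumann_lt_dirichlet :
  (forall x y, 0 <= x -> x <= y -> y <= r -> W y <= W x) -> W r < W 0 ->
  nu 2%N < la 1%N.
Proof.
move=> Wmono W0r; have Cpos := C_positive_upto_dirichlet (lexx _).
have [u hu u0] := listed_eigenvalue laD (isT : (1 <= 1)%N).
have [al [be [h h1 h2]]] := dirichlet_eigenfunction hu.
have Sr := S_end_gt0 famC famS r0 Cpos.
have b0 : be = 0 by move/eqP: h2; rewrite mulf_eq0 (gt_eqF Sr) orbF => /eqP.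
have Cr : C (la 1%N) r = 0.
  move/eqP: h1; rewrite mulf_eq0 => /orP[/eqP a0|/eqP//].
  exfalso; apply: u0; apply: same_ae_imply h => x _ ->.
  by rewrite a0 b0 !mul0r addr0.
have S'r := decreasing_odd_neumann cW famC famS r0 Cpos Wmono W0r Cr.
have [s [t [sl tl st es et]]] := two_neumann_below WM famC famS r0 Cpos Cr S'r.
have [j j1 mj] := eigenvalue_listed nuN (C_neumann es) (@C_nonzero s).
have [k k1 mk] := eigenvalue_listed nuN (S_neumann et) (@S_nonzero t).
have jk : j != k by apply/eqP => e; move: st; rewrite -mj -mk e eqxx.
have below i : (2 <= i)%N -> nu i < la 1%N -> nu 2%N < la 1%N.
  by move=> i2; apply: le_lt_trans; exact: nuN.1.
have [j2|j2] := leqP 2 j; first by apply: (below j) => //; rewrite mj.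
apply: (below k); last by rewrite mk.
have j1' : j = 1%N by apply/eqP; rewrite eqn_leq -ltnS j2.
by rewrite ltn_neqAle k1 andbT -j1'.
Qed.

End Eigenfunctions.

(** * Extending an even convex potential *)

Section ConvexExtension.
Context {R : realType}.
Implicit Types (x y z s t c : R).
Variables (r M : R) (U : R -> R).
Hypotheses (r0 : 0 < r) (UM : forall x, `|x| < r -> `|U x| <= M)
  (Ueven : forall x, `|x| < r -> U (- x) = U x)
  (Uconvex : convex_on `](- r), r[ U).

Let memI x : (x \in (`](- r), r[)%classic) = (`|x| < r).
Proof. by apply/idP/idP; rewrite inE /= in_itv /= ltr_norml. Qed.

Lemma convex_combination t x y : 0 <= t -> t <= 1 -> `|x| < r -> `|y| < r ->
  U (t * x + (1 - t) * y) <= t * U x + (1 - t) * U y.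
Proof.
move=> t0 t1 xr yr.
have := @Uconvex (Itv01 t0 t1) x y; rewrite !memI => /(_ xr yr).
by rewrite !convRE.
Qed.

(** [x] lies between [- y] and [y], where [U] takes the same value. *)
Lemma even_convex_le x y : `|x| <= `|y| -> `|y| < r -> U x <= U y.
Proof.
move=> xy yr; have Ny : `|- y| < r by rewrite normrN.
have [y0|y0] := eqVneq y 0.
  by move: xy; rewrite y0 normr0 normr_le0 => /eqP ->.
have py : 0 < `|y| by rewrite normr_gt0.
pose t := (x / y + 1) / 2.
have xy1 : `|x / y| <= 1 by rewrite normf_div ler_pdivrMr// mul1r.
have [t0 t1] : 0 <= t /\ t <= 1.
  by move: xy1; rewrite ler_norml /t => /andP[? ?]; split; lra.
have := convex_combination t0 t1 yr Ny; rewrite Ueven//.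
have -> : t * y + (1 - t) * - y = x by rewrite /t; field.
by have -> : t * U y + (1 - t) * U y = U y by ring.
Qed.

Let L := sup [set U x | x in [set x | `|x| < r]].

Let U_has_sup : has_sup [set U x | x in [set x | `|x| < r]].
Proof.
split; first by exists (U 0), 0 => //=; rewrite normr0.
by exists M => _ [x xr <-]; apply: le_trans (ler_norm _) (UM xr).
Qed.

Let U_le_L x : `|x| < r -> U x <= L.
Proof. by move=> xr; apply: ub_le_sup; [case: U_has_sup|exists x]. Qed.

(** Outside the interval the value is the supremum, which is the limit at both
    ends because [U] is monotone in [|x|]. *)
Definition continuous_extension x : R := if `|x| < r then U x else L.

Local Notation W := continuous_extension.

Lemma extension_inside x : `|x| < r -> W x = U x.
Proof. by rewrite /W => ->. Qed.

Let extension_outside x : r <= `|x| -> W x = L.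
Proof. by rewrite /W ltNge => ->. Qed.

Lemma extension_even x : W (- x) = W x.
Proof. by rewrite /W normrN; case: ifP => // xr; exact: Ueven. Qed.

Lemma extension_monotone x y : 0 <= x -> x <= y -> W x <= W y.
Proof.
move=> x0 xy; rewrite /W !ger0_norm//; last exact: le_trans xy.
have [yr|yr] := ltP y r.
  rewrite (le_lt_trans xy yr); apply: even_convex_le; rewrite !ger0_norm//.
  - exact: le_trans xy.
  - exact: le_trans xy.
by case: ifP => // xr; apply: U_le_L; rewrite ger0_norm.
Qed.

Lemma extension_bounded x : `|W x| <= M.
Proof.
rewrite /W; case: ifP => xr; first exact: UM.
have := UM (x := 0); rewrite normr0 => /(_ r0); rewrite ler_norml => /andP[h1 h2].
rewrite ler_norml; apply/andP; split.
  by apply: (le_trans h1); apply: U_le_L; rewrite normr0.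
apply: ge_sup; first by case: U_has_sup.
by move=> _ [z zr <-]; apply: le_trans (ler_norm _) (UM zr).
Qed.

(** The upper bound uses the chord from [x] to the far point [x + d], the lower
    bound the chord from [x - d] to the near point. *)
Lemma convex_local_lipschitz x d t : 0 < d -> `|x - d| < r -> `|x + d| < r ->
  0 <= t -> t <= 1 ->
  `|U (x + t * d) - U x| <= 2 * M * t /\ `|U (x - t * d) - U x| <= 2 * M * t.
Proof.
move=> d0 xd1 xd2 t0 t1.
have between z : x - d <= z -> z <= x + d -> `|z| < r.
  move: xd1 xd2; rewrite !ltr_norml => /andP[? ?] /andP[? ?] h1 h2.
  by apply/andP; split; lra.
have M0 : 0 <= M := le_trans (normr_ge0 _) (UM xd1).
have xr : `|x| < r by apply: between; lra.
have half e : `|x - e| < r -> `|x + e| < r -> `|x + t * e| < r ->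
    `|U (x + t * e) - U x| <= 2 * M * t.
  move=> b1 b2 b3.
  have up := convex_combination t0 t1 b2 xr.
  have t1' : 0 < 1 + t by lra.
  have s0 : 0 <= (1 + t)^-1 by rewrite invr_ge0 ltW.
  have s1 : (1 + t)^-1 <= 1 by rewrite invf_le1// lerDl.
  have lo := convex_combination s0 s1 b3 b1.
  rewrite (_ : t * (x + e) + (1 - t) * x = x + t * e) in up; last by ring.
  rewrite (_ : (1 + t)^-1 * (x + t * e) + (1 - (1 + t)^-1) * (x - e) = x) in lo;
    last by field; rewrite gt_eqF.
  have {}lo : (1 + t) * U x <= U (x + t * e) + t * U (x - e).
    have -> : U (x + t * e) + t * U (x - e) = (1 + t) *
      ((1 + t)^-1 * U (x + t * e) + (1 - (1 + t)^-1) * U (x - e)).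
      by field; rewrite gt_eqF.
    by rewrite ler_pM2l.
  have := UM xr; have := UM b1; have := UM b2; rewrite !ler_norml.
  move=> /andP[h1 h2] /andP[h3 h4] /andP[h5 h6]; apply/andP; split; nra.
have td0 : 0 <= t * d by rewrite mulr_ge0// ltW.
have td1 : t * d <= d by rewrite ler_piMl// ltW.
split; first by apply: half => //; apply: between; lra.
have := half (- d); rewrite opprK mulrN; apply => //.
by apply: between; lra.
Qed.

Lemma extension_continuous : continuous W.
Proof.
move=> x; apply/cvgrPdist_le => /= e e0.
have [xr|rx] := ltP `|x| r.
  pose d := (r - `|x|) / 2.
  have d0 : 0 < d by rewrite divr_gt0// subr_gt0.
  have M0 : 0 <= M := le_trans (normr_ge0 _) (UM xr).
  have K0 : 0 < 2 * M + 1 by lra.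
  have ed : 0 < e / (2 * M + 1) * d by rewrite mulr_gt0// divr_gt0.
  have b1 : `|x - d| < r.
    by apply: (le_lt_trans (ler_normB _ _)); rewrite (gtr0_norm d0) /d; lra.
  have b2 : `|x + d| < r.
    by apply: (le_lt_trans (ler_normD _ _)); rewrite (gtr0_norm d0) /d; lra.
  near=> y.
  have xyd : `|x - y| <= d by near: y; apply: cvgr_dist_le => //; exact: cvg_id.
  have xye : `|x - y| <= e / (2 * M + 1) * d.
    by near: y; apply: cvgr_dist_le => //; exact: cvg_id.
  have yr : `|y| < r.
    rewrite (_ : y = x - (x - y)); last by ring.
    by apply: (le_lt_trans (ler_normB _ _)); rewrite /d in xyd; lra.
  rewrite !extension_inside//.
  pose t := `|x - y| / d.
  have t0 : 0 <= t by rewrite divr_ge0// ltW.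
  have t1 : t <= 1 by rewrite ler_pdivrMr// mul1r.
  have te : 2 * M * t <= e.
    have h : t <= e / (2 * M + 1) by rewrite ler_pdivrMr.
    have h2 : t * (2 * M + 1) <= e by rewrite -ler_pdivlMr.
    lra.
  have [l1 l2] := convex_local_lipschitz d0 b1 b2 t0 t1.
  have tdE : t * d = `|x - y| by rewrite /t divfK// gt_eqF.
  rewrite distrC; rewrite tdE in l1 l2.
  have [yx|/ltW xy] := leP y x.
    have nE : `|x - y| = x - y by rewrite ger0_norm ?subr_ge0.
    rewrite nE (_ : x - (x - y) = y) in l2; last by ring.
    exact: le_trans te.
  have nE : `|x - y| = - (x - y) by rewrite ler0_norm ?subr_le0.
  rewrite nE (_ : x + - (x - y) = y) in l1; last by ring.
  exact: le_trans te.
have Le : L - e < L by lra.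
have [_ [z zr <-] hz] := sup_adherent e0 U_has_sup.
have zx : `|z| < `|x| := lt_le_trans zr rx.
have close y : `|z| <= `|y| -> L - e <= W y /\ W y <= L.
  move=> zy; have [yr|yr] := ltP `|y| r.
    rewrite extension_inside//; split; last exact: U_le_L.
    by apply: (le_trans (ltW hz)); exact: even_convex_le.
  by rewrite extension_outside//; split; lra.
near=> y.
have zy : `|z| <= `|y|.
  have : `| `|x| - `|y| | <= `|x| - `|z|.
    near: y; apply: cvgr_dist_le; last by rewrite subr_gt0.
    exact: norm_continuous.
  by move=> /ler_normlP[? ?]; lra.
have [h1 h2] := close y zy.
rewrite (extension_outside rx) ger0_norm ?subr_ge0//; lra.
Unshelve. all: by end_near. Qed.

(** By monotonicity, equality of the values at [0] and [r] would make [U]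
    constant. *)
Lemma extension_increases : ~ constant_on `](- r), r[ U -> W 0 < W r.
Proof.
move=> ncst; rewrite lt_neqAle extension_monotone// ?ltW// andbT; apply/eqP => e.
apply: ncst; exists (U 0) => x; rewrite memI => xr.
apply/eqP; rewrite eq_le; apply/andP; split; last first.
  by apply: even_convex_le; rewrite ?normr0.
have <- : W 0 = U 0 by rewrite extension_inside// normr0.
by rewrite e extension_outside ?U_le_L// gtr0_norm.
Qed.

End ConvexExtension.

Theorem corollary3p4 (R : realType) (r : R) (V : R -> R) (mu lambda : nat -> R)
  (r_gt0 : 0 < r)
  (V_bounded : [bounded V x | x in `](- r), r[])
  (V_measurable : measurable_fun `](- r), r[ V)
  (V_symmetric : forall x, x \in `](- r), r[ -> V (- x) = V x)
  (mu_neumann : eigenvalues (- r) r (neumann_schrodinger (- r) r V) mu)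
  (lambda_dirichlet :
     eigenvalues (- r) r (dirichlet_schrodinger (- r) r V) lambda) :
  (convex_on `](- r), r[ V -> ~ constant_on `](- r), r[ V ->
     lambda 1%N < mu 2%N) /\
  (concave_on `](- r), r[ V -> ~ constant_on `](- r), r[ V ->
     mu 2%N < lambda 1%N).
Proof.
have memI (x : R) : (x \in `](- r), r[) = (`|x| < r) by rewrite in_itv /= ltr_norml.
have [M VM] : exists M, forall x : R, `|x| < r -> `|V x| <= M.
  have [M [_ hM]] := V_bounded; exists (M + 1) => x xr.
  by apply: (hM (M + 1)); [rewrite ltrDl|rewrite /= memI].
have Veven (x : R) : `|x| < r -> V (- x) = V x.
  by move=> xr; apply: V_symmetric; rewrite memI.
split=> hV ncst.
- pose W := continuous_extension r V.
  have cW : continuous W := extension_continuous r_gt0 VM Veven hV.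
  have WM x : `|W x| <= M := extension_bounded r_gt0 VM x.
  have We x : W (- x) = W x := extension_even Veven x.
  have VW x : x \in `](- r), r[ -> V x = W x.
    by rewrite memI => xr; rewrite /W extension_inside.
  have [C [C' famC]] := solution_family_exists cW WM 1 0.
  have [S [S' famS]] := solution_family_exists cW WM 0 1.
  apply: (dirichlet_lt_neumann r_gt0 cW WM We VW famC famS mu_neumann
    lambda_dirichlet).
    by move=> x y x0 xy _; exact: (extension_monotone r_gt0 VM Veven hV).
  exact: (extension_increases r_gt0 VM Veven hV).
- pose U x := - V x.
  have UM (x : R) : `|x| < r -> `|U x| <= M by rewrite /U normrN; exact: VM.
  have Ue (x : R) : `|x| < r -> U (- x) = U x by rewrite /U => /Veven ->.
  have ncstU : ~ constant_on `](- r), r[ U.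
    by move=> [c hc]; apply: ncst; exists (- c) => x /hc <-; rewrite /U opprK.
  pose W x := - continuous_extension r U x.
  have cW : continuous W.
    by move=> x; apply: continuousN; exact: (extension_continuous r_gt0 UM Ue hV).
  have WM x : `|W x| <= M by rewrite /W normrN; exact: (extension_bounded r_gt0 UM).
  have We x : W (- x) = W x by rewrite /W (extension_even Ue).
  have VW x : x \in `](- r), r[ -> V x = W x.
    by rewrite memI => xr; rewrite /W extension_inside// /U opprK.
  have [C [C' famC]] := solution_family_exists cW WM 1 0.
  have [S [S' famS]] := solution_family_exists cW WM 0 1.
  apply: (neumann_lt_dirichlet r_gt0 cW WM We VW famC famS mu_neumann
    lambda_dirichlet).
    move=> x y x0 xy _; rewrite /W lerN2.
    exact: (extension_monotone r_gt0 UM Ue hV).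
  by rewrite /W ltrN2; exact: (extension_increases r_gt0 UM Ue hV).
Qed.
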